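(* Let $\alpha>2$, $\lambda_E>0$, $N\ge 1$, let $A_1,\dots,A_{N+1}$ be distinct points of $\mathbb{R}^2$ (an $N$-hop path) and let $p_{A_1},\dots,p_{A_N}>0$ be transmit powers. Let $\Phi_E$ be the homogeneous Poisson point process of non-colluding eavesdroppers, with density $\lambda_E$ on $\mathbb{R}^2$, and let the channel coefficients be as in the context. Then the secure connection probability of the path for non-colluding eavesdroppers, $$\mathcal{P}_N=\mathcal{P}\left(\log_2\left(\frac{1+\min_{i=1,\dots,N}\left\{\frac{p_{A_i}|h_{A_iA_{i+1}}|^2}{d_{A_iA_{i+1}}^{\alpha}}\right\}}{1+\max_{E_j\in\Phi_E}\left\{\sum_{k=1}^{N}\frac{p_{A_k}|h_{A_kE_j}|^2}{d_{A_kE_j}^{\alpha}}\right\}}\right)>0\right),$$ is given by $$\mathcal{P}_N=\mathbb{E}\left\{\exp\left[-\lambda_E\int_{\mathbb{R}^2}\sum_{k=1}^{N}\left(\prod_{m=1,\,m\neq k}^{N}\frac{p_{A_m}^{-1}d_{A_m x}^{\alpha}}{p_{A_m}^{-1}d_{A_m x}^{\alpha}-p_{A_k}^{-1}d_{A_k x}^{\alpha}}\right)\exp\left[-\frac{d_{A_k x}^{\alpha}}{p_{A_k}}\min_{i=1,\dots,N}\left\{\frac{p_{A_i}|h_{A_iA_{i+1}}|^2}{d_{A_iA_{i+1}}^{\alpha}}\right\}\right]dx\right]\right\},$$ where the expectation is over $h_{A_iA_{i+1}}$, $i=1,\dots,N$.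
   Context: $d_{XY}$ denotes the Euclidean distance between the points $X,Y\in\mathbb{R}^2$. $\Phi_E=\{E_j\}$ is a homogeneous Poisson point process on $\mathbb{R}^2$ with density $\lambda_E$. The squared magnitudes $|h_{A_iA_{i+1}}|^2$ ($i=1,\dots,N$) and $|h_{A_kE_j}|^2$ ($k=1,\dots,N$, $E_j\in\Phi_E$) are exponentially distributed with mean one, mutually independent and independent of $\Phi_E$. The integrand is defined for almost every $x\in\mathbb{R}^2$ (all denominators are nonzero off a null set); an empty product equals $1$. *)

(* Defs.v *)
From mathcomp Require Export all_boot all_order all_algebra.
From mathcomp Require Export all_classical all_reals all_analysis.
From mathcomp Require Export measurable_realfun.
Export Order.TTheory GRing.Theory Num.Theory.
Export numFieldNormedType.Exports.

Set Implicit Arguments.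
Unset Strict Implicit.
Unset Printing Implicit Defensive.

#[global] Open Scope classical_set_scope.
#[global] Open Scope ring_scope.

Definition plane_dist {R : realType} (x y : R * R) : R :=
  Num.sqrt ((x.1 - y.1) ^+ 2 + (x.2 - y.2) ^+ 2).

(* measurableTypeR R is R with the Borel sigma-algebra on which the library
   defines lebesgue_measure. *)
Definition plane (R : realType) : measurableType _ :=
  (measurableTypeR R * measurableTypeR R)%type.

Definition area {R : realType} : {measure set (plane R) -> \bar R} :=
  (@lebesgue_measure R \x @lebesgue_measure R)%E.

(* Binary logarithm on extended reals, with value -oo at every x <= 0. *)
Definition log2e {R : realType} (x : \bar R) : \bar R :=
  (lne x * ((ln 2)^-1)%:E)%E.

Definition mutually_independent {d d'} {T : measurableType d}
    {S : measurableType d'} {R : realType} (P : probability T R)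
    {I : eqType} (X : I -> T -> S) : Prop :=
  forall (s : seq I) (B : I -> set S), uniq s ->
    (forall i, measurable (B i)) ->
    P (\bigcap_(i in [set` s]) X i @^-1` B i) =
    (\prod_(i <- s) P (X i @^-1` B i))%E.

Definition generated_sigma {d d'} {T : measurableType d}
    {S : measurableType d'} {I : Type} (X : I -> T -> S) : set (set T) :=
  <<s \bigcup_i preimage_set_system setT (X i) measurable >>.

Definition independent_families {d d1 d2} {T : measurableType d}
    {S1 : measurableType d1} {S2 : measurableType d2} {R : realType}
    (P : probability T R) {I J : Type}
    (X : I -> T -> S1) (Y : J -> T -> S2) : Prop :=
  forall U V, generated_sigma X U -> generated_sigma Y V ->
    P (U `&` V) = (P U * P V)%E.

(* A point process on the plane is given by an enumeration (E j)_j of its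
   points. Since a homogeneous Poisson process of positive density has
   infinitely many points almost surely, the whole of nat can be used. *)
Definition point_count {d} {T : measurableType d} {R : realType}
    (E : nat -> T -> plane R) (B : set (plane R)) (w : T) : \bar R :=
  (\sum_(0 <= j <oo) \d_(E j w) B)%E.

(* poisson_prob takes a second argument of type nat, which it ignores. *)
Definition homogeneous_poisson_process {d} {T : measurableType d}
    {R : realType} (P : probability T R) (lambda : R)
    (E : nat -> {RV P >-> plane R}) : Prop :=
  (forall (B : set (plane R)) (n : nat), measurable B -> (area B < +oo)%E ->
     P [set w | point_count E B w = n%:R%:E] =
     poisson_prob (lambda * fine (area B)) 0%N [set n]) /\
  (forall (m : nat) (B : 'I_m -> set (plane R)),
     (forall i, measurable (B i)) -> trivIset setT B ->
     mutually_independent P (fun i => point_count E (B i))).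

Section Path.
Context {R : realType} {N : nat}.
Variables (A : 'I_N.+1 -> R * R) (p : 'I_N -> R) (alpha : R).

(* With hops indexed from 0, hop i goes from A i to A (i + 1). *)
Definition tx (i : 'I_N) : R * R := A (widen_ord (leqnSn N) i).
Definition rx (i : 'I_N) : R * R := A (lift ord0 i).

Section Gains.
Context {d} {T : measurableType d} {P : probability T R}.
(* g i stands for |h_{A_i A_{i+1}}|^2, gE k j for |h_{A_k E_j}|^2. *)
Variables (g : 'I_N -> {RV P >-> R}) (gE : 'I_N -> nat -> {RV P >-> R})
  (E : nat -> {RV P >-> plane R}).

Definition hop_snr (i : 'I_N) (w : T) : R :=
  p i * g i w / plane_dist (tx i) (rx i) `^ alpha.

(* The neutral element is itself one of the hop values, so that this is the
   minimum over the (nonempty) set of hops. *)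
Definition min_hop_snr (N_gt0 : (0 < N)%N) (w : T) : R :=
  \big[Num.min/hop_snr (Ordinal N_gt0) w]_(i < N) hop_snr i w.

Definition eve_snr (j : nat) (w : T) : R :=
  \sum_(k < N) p k * gE k j w / plane_dist (tx k) (E j w) `^ alpha.

(* Supremum in the extended reals; almost surely it is a finite maximum. *)
Definition max_eve_snr (w : T) : \bar R :=
  ereal_sup (range (fun j => (eve_snr j w)%:E)).

Definition secure_connection_probability (N_gt0 : (0 < N)%N) : \bar R :=
  P [set w | 0 < log2e ((1 + (min_hop_snr N_gt0 w)%:E) /
                        (1 + max_eve_snr w))]%E.

Definition all_gains (c : 'I_N + 'I_N * nat) : T -> R :=
  match c with inl i => g i | inr (k, j) => gE k j end.

End Gains.

Definition scaled_loss (k : 'I_N) (x : R * R) : R :=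
  (p k)^-1 * plane_dist (tx k) x `^ alpha.

(* The denominators vanish only on a null set of points x, where the
   convention 0^-1 = 0 gives the integrand an irrelevant value. *)
Definition scp_integrand (t : R) (x : R * R) : R :=
  \sum_(k < N)
    (\prod_(m < N | m != k)
       (scaled_loss m x / (scaled_loss m x - scaled_loss k x))) *
    expR (- (plane_dist (tx k) x `^ alpha / p k * t)).

End Path.

(* Main.v *)
(** Conditionally on the positions [E_j] and on the hop gains, the eavesdroppers
are independent, and the one at position [x] fails to decode at threshold [t]
with probability [1 - q t x], where [q t x] is the tail of a sum of independent
exponential variables of rates [d_{A_k x}^alpha / p_k].  Off a null set of
positions these rates are distinct, so this hypoexponential tail is the
partial-fraction expression in the integrand.  Averaging the product of the
[1 - q t (E_j)] over the Poisson process gives [exp (- lambda * \int q t)],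
by the Laplace functional applied to [- ln (1 - q t)].  It remains to average
over [t], the minimal hop SNR; its law has no atoms, so the strict and the
large inequality between it and the best eavesdropper SNR agree almost surely. *)

Require Import Defs.
From HB Require Import structures.
From mathcomp Require Import ring lra.

Set Implicit Arguments.
Unset Strict Implicit.
Unset Printing Implicit Defensive.

(** * Independence of sigma-algebras *)

(** Neither conditional expectations nor infinite products of measures are formed. Conditioning on a
    block of variables is Tonelli's theorem for the identity map from [T] into [T] with a coarser
    sigma-algebra: independence of two such sigma-algebras says that the law of the pair of
    identities is a product measure. In this way the countably many eavesdropper gains count as one
    random element. The integrand is a sum of terms that may have opposite signs, so its bounds are
    read off from its meaning as a tail probability. It must be strictly below 1 for its logarithm,
    and integrable over the plane. Both hold at thresholds [t > 0] only, since at [t = 0] the tail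
    is 1; this is why the minimal hop SNR has to be almost surely positive. Integrability rests on a
    Gaussian bound, available because the loss exponent is at least 2. The product over infinitely
    many eavesdroppers is the exponential of minus a series that may diverge for some realisations,
    whence a kernel [expNe] defined up to [+oo]. *)

Section measurable_sets.
Context {d} {T : measurableType d} {R : realType}.
Implicit Types f g : T -> R.

Lemma measurable_set_ltr f g : measurable_fun setT f -> measurable_fun setT g ->
  measurable [set x | f x < g x].
Proof.
move=> /measurable_EFinP mf /measurable_EFinP mg.
by have := measurable_lte measurableT mf mg; rewrite setTI.
Qed.

Lemma measurable_set_ler f g : measurable_fun setT f -> measurable_fun setT g ->
  measurable [set x | f x <= g x].
Proof.
move=> mf mg; rewrite (_ : [set x | _] = ~` [set x | g x < f x]).
  exact/measurableC/measurable_set_ltr.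
by apply/seteqP; split => x /=; rewrite leNgt => /negP.
Qed.

End measurable_sets.

Section independence.
Local Open Scope ereal_scope.
Context {d} {T : measurableType d} {R : realType} (P : probability T R).

Definition independent_systems (G H : set (set T)) :=
  forall U V, G U -> H V -> P (U `&` V) = P U * P V.

Lemma independent_systemsC G H :
  independent_systems G H -> independent_systems H G.
Proof. by move=> GH U V HU GV; rewrite setIC muleC GH. Qed.

(** Dynkin's argument: for a fixed [V] in [H], the events that satisfy the product rule with [V]
    form a lambda-system, and it contains the pi-system [G]. *)
Lemma independent_systems_sigmal (G H : set (set T)) :
  G `<=` measurable -> H `<=` measurable -> setI_closed G ->
  independent_systems G H -> independent_systems <<s G >> H.
Proof.
move=> Gm Hm GI GH U V + HV; move: U.
pose D := [set U | measurable U /\ P (U `&` V) = P U * P V].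
have mV := Hm _ HV.
suff : <<s G >> `<=` D by move=> GD U /GD [].
apply: lambda_system_subset => //.
- split => //.
  + by split => //; rewrite setTI probability_setT mul1e.
  + move=> A B BA [mA PA] [mB PB]; split; first exact: measurableD.
    have -> : (A `\` B) `&` V = (A `&` V) `\` (B `&` V).
      apply/seteqP; split => [x [[Ax nBx] Vx]|x [[Ax Vx] nBx]].
        by split => // -[].
      by split => //; split => // Bx; apply: nBx.
    have mAV : measurable (A `&` V) by exact: measurableI.
    have mBV : measurable (B `&` V) by exact: measurableI.
    rewrite !measureD//; last 2 first.
    * by rewrite ltey_eq fin_num_measure.
    * by rewrite ltey_eq fin_num_measure.
    rewrite (setIidr BA) (setIidr (setSI BA)).
    rewrite [X in X - _]PA [X in _ - X]PB -muleBl//.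
      exact: fin_num_measure.
    by rewrite fin_num_adde_defr// fin_num_measure.
  + move=> F ndF FD; have mF n : measurable (F n) by have [] := FD n.
    have mU : measurable (\bigcup_n F n) by exact: bigcup_measurable.
    split => //; rewrite setI_bigcupl.
    have mFV n : measurable (F n `&` V) by apply: measurableI.
    have c1 : P (F n `&` V) @[n --> \oo] --> P (\bigcup_n (F n `&` V)).
      apply: nondecreasing_cvg_mu => //; first exact: bigcup_measurable.
      by move=> m n mn; apply/subsetPset; apply: setSI; apply/subsetPset/ndF.
    have c2 : P (F n `&` V) @[n --> \oo] --> P (\bigcup_n F n) * P V.
      rewrite (_ : (fun n => P (F n `&` V)) = (fun n => P (F n) * P V)); last first.
        by apply/funext => n; have [] := FD n.
      apply: cvgeZr; first exact: fin_num_measure.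
      exact: nondecreasing_cvg_mu.
    exact: cvg_unique c1 c2.
- by move=> U GU; split; [exact: Gm|exact: GH].
Qed.

Lemma independent_systems_sigma (G H : set (set T)) :
  G `<=` measurable -> H `<=` measurable ->
  setI_closed G -> setI_closed H ->
  independent_systems G H -> independent_systems <<s G >> <<s H >>.
Proof.
move=> Gm Hm GI HI GH.
apply: independent_systems_sigmal => //.
  by apply: smallest_sub => //; exact: sigma_algebra_measurable.
apply: independent_systemsC; apply: independent_systems_sigmal => //.
exact: independent_systemsC.
Qed.

(* Applied to identity maps into coarser sigma-algebras, this integrates over
   independent families of any size without infinite products of measures. *)
Lemma ge0_integral_independent {d1 d2} {S1 : measurableType d1}
    {S2 : measurableType d2} (X : T -> S1) (Y : T -> S2)
    (f : S1 * S2 -> \bar R) :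
  measurable_fun setT X -> measurable_fun setT Y ->
  (forall A B, measurable A -> measurable B ->
    P (X @^-1` A `&` Y @^-1` B) = P (X @^-1` A) * P (Y @^-1` B)) ->
  measurable_fun setT f -> (forall z, 0 <= f z) ->
  \int[P]_w f (X w, Y w) = \int[P]_w1 \int[P]_w2 f (X w1, Y w2).
Proof.
move=> mX mY XY mf f0.
have mXY : measurable_fun setT (fun w => (X w, Y w)).
  exact: measurable_fun_pair.
pose X' : {mfun T >-> S1} := HB.pack X (isMeasurableFun.Build _ _ _ _ X mX).
pose Y' : {mfun T >-> S2} := HB.pack Y (isMeasurableFun.Build _ _ _ _ Y mY).
pose XY' : {mfun T >-> (S1 * S2)%type} :=
  HB.pack (fun w => (X w, Y w)) (isMeasurableFun.Build _ _ _ _ _ mXY).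
rewrite -(ge0_integral_distribution (P := P) XY')//.
(* The joint law and the product of the marginal laws agree on rectangles, which determines a
   product measure. *)
have -> : \int[distribution P XY']_y f y =
    \int[distribution P X' \x distribution P Y']_y f y.
  apply: eq_measure_integral => D mD _; apply/esym.
  by apply: product_measure_unique.
rewrite fubini_tonelli1// ge0_integral_distribution//; last 2 first.
- exact: measurable_fun_fubini_tonelli_F.
- by move=> x; apply: integral_ge0.
apply: eq_integral => w _; rewrite /= /fubini_F ge0_integral_distribution//.
exact: measurableT_comp mf (pair1_measurable _).
Qed.

End independence.

Section sub_sigma.
Local Open Scope ereal_scope.
Context {d d'} {T : measurableType d} {S : measurableType d'} {R : realType}
  (P : probability T R) {I : Type} (X : I -> T -> S).

Definition preimages_over (K : set I) : set (set T) :=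
  \bigcup_(i in K) preimage_set_system setT (X i) measurable.

Definition sigma_over (K : set I) : set (set T) := <<s preimages_over K >>.

Lemma sigma_over_generated (K : set I) : sigma_over K `<=` generated_sigma X.
Proof.
apply: sub_sigma_algebra2 => A [i Ki XA]; exact: (@bigcup_sup _ _ i).
Qed.

Hypothesis mX : forall i, measurable_fun setT (X i).

Lemma preimages_over_measurable (K : set I) : preimages_over K `<=` measurable.
Proof. by move=> A [i Ki [B mB <-]]; exact: mX. Qed.

Lemma sigma_over_measurable (K : set I) : sigma_over K `<=` measurable.
Proof.
apply: smallest_sub; first exact: sigma_algebra_measurable.
exact: preimages_over_measurable.
Qed.

Lemma measurable_sigma_over (K : set I) i : K i ->
  measurable_fun setT (X i : g_sigma_algebraType (preimages_over K) -> S).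
Proof.
move=> Ki _ B mB; rewrite setTI; apply: sub_gen_smallest; exists i => //.
by exists B => //; rewrite setTI.
Qed.

Lemma measurable_id_sigma_over (K : set I) :
  measurable_fun setT (id : T -> g_sigma_algebraType (preimages_over K)).
Proof. by move=> _ B mB; rewrite setTI; exact: sigma_over_measurable mB. Qed.

End sub_sigma.

(** * Disjoint blocks of a mutually independent family *)

Section mutual_independence.
Local Open Scope ereal_scope.
Context {d d'} {T : measurableType d} {S : measurableType d'} {R : realType}
  (P : probability T R) {I : eqType} (X : I -> T -> S).
Hypothesis mX : forall i, measurable_fun setT (X i).
Hypothesis XI : mutually_independent P X.

(** Preimages under single variables are not stable under intersection; finite cylinders are, and
    they generate the same sigma-algebra. Asking [B i = setT] outside of [s] lets two cylinders be
    rewritten over a common list of indices. *)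
Let cylinder (K : set I) : set (set T) :=
  [set A | exists s (B : I -> set S), [/\ uniq s, [set` s] `<=` K,
    forall i, measurable (B i), forall i, i \notin s -> B i = setT &
    A = \bigcap_(i in [set` s]) X i @^-1` B i]].

Let cylinder_measurable K : cylinder K `<=` measurable.
Proof.
move=> A [s [B [us sK mB BT ->]]]; apply: fin_bigcap_measurable => // i _.
by rewrite -[X in measurable X]setTI; exact: mX.
Qed.

Let cylinder_widen (s s' : seq I) (B : I -> set S) : {subset s <= s'} ->
  (forall i, i \notin s -> B i = setT) ->
  \bigcap_(i in [set` s]) X i @^-1` B i = \bigcap_(i in [set` s']) X i @^-1` B i.
Proof.
move=> ss' BT; apply/seteqP; split => w H i /= si; last exact: H (ss' _ si).
have [/H//|/BT] := boolP (i \in s).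
by rewrite /preimage /= => ->.
Qed.

Let cylinder_setI K : setI_closed (cylinder K).
Proof.
move=> A1 A2 [s1 [B1 [us1 sK1 mB1 BT1 ->]]] [s2 [B2 [us2 sK2 mB2 BT2 ->]]].
exists (undup (s1 ++ s2)), (fun i => B1 i `&` B2 i); split.
- exact: undup_uniq.
- by move=> i /=; rewrite mem_undup mem_cat => /orP[/sK1|/sK2].
- by move=> i; apply: measurableI.
- move=> i; rewrite mem_undup mem_cat negb_or => /andP[i1 i2].
  by rewrite BT1// BT2// setTI.
- rewrite (@cylinder_widen s1 (undup (s1 ++ s2)) B1 _ BT1); last first.
    by move=> i i1; rewrite mem_undup mem_cat i1.
  rewrite (@cylinder_widen s2 (undup (s1 ++ s2)) B2 _ BT2); last first.
    by move=> i i1; rewrite mem_undup mem_cat i1 orbT.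
  by rewrite -bigcapI.
Qed.

Lemma independent_sigma_over (K L : set I) : K `&` L = set0 ->
  independent_systems P (sigma_over X K) (sigma_over X L).
Proof.
move=> KL.
have sub M : sigma_over X M `<=` <<s cylinder M >>.
  apply: sub_sigma_algebra2 => A [i Mi [B mB <-]].
  exists [:: i], (fun j => if j == i then B else setT); split => //.
  - by move=> j; rewrite /= inE => /eqP ->.
  - by move=> j; case: ifP.
  - by move=> j; rewrite inE => /negPf ->.
  - rewrite setTI; apply/seteqP; split => [w Bw j|w /(_ i)] /=.
      by rewrite inE => /eqP ->; rewrite eqxx.
    by rewrite inE eqxx; apply.
move=> U V /sub KU /sub LV.
move: U V KU LV; apply: independent_systems_sigma => //.
move=> _ _ [s1 [B1 [us1 sK1 mB1 BT1 ->]]] [s2 [B2 [us2 sK2 mB2 BT2 ->]]].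
have s12 i : i \in s1 -> i \notin s2.
  move=> i1; apply/negP => i2; suff : (K `&` L) i by rewrite KL.
  by split; [exact: sK1|exact: sK2].
(* Each family is [setT] off its own list, and the lists are disjoint, so [B] equals [B1] on [s1]
   and [B2] on [s2]. *)
pose B i := B1 i `&` B2 i.
have -> : \bigcap_(i in [set` s1]) X i @^-1` B1 i `&`
    \bigcap_(i in [set` s2]) X i @^-1` B2 i =
    \bigcap_(i in [set` s1 ++ s2]) X i @^-1` B i.
  rewrite (@cylinder_widen s1 (s1 ++ s2) B1 _ BT1); last first.
    by move=> i i1; rewrite mem_cat i1.
  rewrite (@cylinder_widen s2 (s1 ++ s2) B2 _ BT2); last first.
    by move=> i i1; rewrite mem_cat i1 orbT.
  by rewrite -bigcapI.
rewrite XI; last 2 first.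
- rewrite cat_uniq us1 us2 andbT /=; apply/hasPn => i i2.
  by apply/negP => /s12; rewrite i2.
- by move=> i; apply: measurableI.
rewrite big_cat/= (XI us1 mB1) (XI us2 mB2); congr (_ * _).
  by rewrite !big_seq; apply: eq_bigr => i i1; rewrite /B (BT2 _ (s12 _ i1)) setIT.
rewrite !big_seq; apply: eq_bigr => i i2; rewrite /B BT1 ?setTI//.
by apply/negP => /s12; rewrite i2.
Qed.

Lemma mutually_independent_comp {J : eqType} (f : J -> I) : injective f ->
  mutually_independent P (fun j => X (f j)).
Proof.
move=> fI s B us mB.
(* This transports [B] along [f] without an inverse: by injectivity the intersection is the single
   set [B j] at [i = f j], and it is empty, hence [setT], off the range of [f]. *)
pose C i := \bigcap_(j in [set j | f j = i]) B j.
have CE j : C (f j) = B j.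
  by apply/seteqP; split => [x /(_ j erefl)//|x Bx k /= /fI ->].
have mC i : measurable (C i).
  have [[j <-]|Ni] := pselect (exists j, f j = i); first by rewrite CE.
  rewrite (_ : C i = setT)//; apply/seteqP; split => // x _ j /= ji.
  by exfalso; apply: Ni; exists j.
have := @XI (map f s) C; rewrite map_inj_uniq// => /(_ us mC).
rewrite big_map; under [in RHS]eq_bigr do rewrite CE.
move=> <-; congr (P _); apply/seteqP; split => w H i /=.
  by move=> /mapP[j js ->]; rewrite CE; exact: H.
by move=> si; have := H (f i); rewrite CE; apply; exact: map_f.
Qed.

End mutual_independence.

(** * Sums of exponential variables *)

Section density.
Local Open Scope ereal_scope.
Context {d} {T : measurableType d} {R : realType}
  (mu nu : {measure set T -> \bar R}) (p : T -> R).
Hypothesis mp : measurable_fun setT p.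
Hypothesis p0 : forall x, (0 <= p x)%R.
Hypothesis nuE : forall A, measurable A -> nu A = \int[mu]_(x in A) (p x)%:E.

Import HBNNSimple.

Let integral_density_nnsfun (h : {nnsfun T >-> R}) :
  \int[nu]_x (h x)%:E = \int[mu]_x (h x * p x)%:E.
Proof.
under eq_integral do rewrite fimfunE -fsumEFin//.
rewrite ge0_integral_fsum//; last 2 first.
  - by move=> r; exact/measurable_EFinP/measurableT_comp.
  - by move=> n x _; rewrite EFinM nnfun_muleindic_ge0.
under [RHS]eq_integral.
  move=> x _; rewrite EFinM muleC fimfunE -fsumEFin// ge0_mule_fsumr; last first.
    by move=> r; rewrite EFinM nnfun_muleindic_ge0.
  over.
rewrite ge0_integral_fsum//; last 2 first.
  - move=> r; apply: emeasurable_funM; first exact/measurable_EFinP.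
    exact/measurable_EFinP/measurableT_comp.
  - move=> n x _; apply: mule_ge0; first by rewrite lee_fin.
    by rewrite EFinM nnfun_muleindic_ge0.
apply: eq_fsbigr => r rh.
have r0 : (0 <= r)%R by move: rh => /[!inE] -[x _ <-].
under eq_integral do rewrite EFinM.
under [RHS]eq_integral do rewrite EFinM muleCA.
have mh : measurable (h @^-1` [set r]) by exact: measurable_sfunP.
have m1 : measurable_fun setT (fun x => (\1_(h @^-1` [set r]) x)%:E : \bar R).
  exact/measurable_EFinP.
have mp1 : measurable_fun setT (fun x => (p x)%:E * (\1_(h @^-1` [set r]) x)%:E).
  by apply: emeasurable_funM => //; exact/measurable_EFinP.
rewrite !ge0_integralZl//; last by move=> x _; apply: mule_ge0; rewrite lee_fin.
congr (_ * _); rewrite integral_indic// setIT nuE//.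
rewrite [LHS]integral_mkcond; apply: eq_integral => x _.
rewrite patchE/= indicE; case: ifPn; rewrite ?mule1 ?mule0//.
Qed.

(** For simple functions this is linearity and [nuE]; both sides then pass to the limit by monotone
    convergence. *)
Lemma ge0_integral_density (f : T -> \bar R) : measurable_fun setT f ->
  (forall x, 0 <= f x) -> \int[nu]_x f x = \int[mu]_x (f x * (p x)%:E).
Proof.
move=> mf f0; pose g := nnsfun_approx measurableT mf.
transitivity (limn (fun n => \int[nu]_x (g n x)%:E)).
  rewrite -monotone_convergence//=.
  - apply: eq_integral => x _; apply/esym/cvg_lim => //=.
    exact: cvg_nnsfun_approx.
  - by move=> n; apply: measurableT_comp => //; exact: measurable_funTS.
  - by move=> n x _; rewrite lee_fin.
  - by move=> x _ a b ab; rewrite lee_fin//; exact/lefP/nd_nnsfun_approx.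
under eq_fun do rewrite integral_density_nnsfun.
rewrite -monotone_convergence//=.
- apply: eq_integral => x _; under eq_fun do rewrite EFinM.
  by apply/cvg_lim => //; apply: cvgeZr => //; exact: cvg_nnsfun_approx.
- by move=> n; apply/measurable_EFinP; exact: measurable_funM.
- by move=> n x _; rewrite lee_fin mulr_ge0.
- move=> x _ a b ab; rewrite lee_fin// ler_wpM2r//.
  exact/lefP/nd_nnsfun_approx.
Qed.

End density.

(** * The identity between partial-fraction weights *)

Section lagrange.
Local Open Scope ring_scope.
Context {F : fieldType} {I : eqType}.

(* Lagrange interpolation of the constant 1, evaluated at 0. *)
Lemma sum_lagrange_weights (s : seq I) (a : I -> F) (k0 : I) : k0 \in s ->
  uniq s -> {in s &, injective a} ->
  \sum_(k <- s) \prod_(m <- s | m != k) (a m / (a m - a k)) = 1.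
Proof.
move=> k0s us ai.
(* The Lagrange basis polynomial of the nodes [a m]: it is 1 at [a k] and 0 at the other nodes. *)
pose L k : {poly F} :=
  \prod_(m <- s | m != k) ((a k - a m)^-1 *: ('X - (a m)%:P)).
have LE k x : (L k).[x] = \prod_(m <- s | m != k) ((x - a m) / (a k - a m)).
  rewrite /L horner_prod; apply: eq_bigr => m _.
  by rewrite hornerZ hornerXsubC mulrC.
have szL k : k \in s -> (size (L k) <= size s)%N.
  move=> ks; rewrite /L.
  have -> : size s = (\sum_(m <- s | m != k) 1).+1.
    rewrite sum1_count -(count_predC (pred1 k) s) count_uniq_mem// ks add1n.
    by congr _.+1; apply: eq_count.
  elim/big_ind2 : _ => //; first by rewrite size_poly1.
    move=> p m q n pm qn; rewrite (leq_trans (size_polyMleq _ _))//.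
    by rewrite -subn1 leq_subLR add1n -addnS -addSn leq_add.
  by move=> i _; rewrite (leq_trans (size_scale_leq _ _))// size_XsubC.
have Ls k j : k \in s -> j \in s -> (L k).[a j] = (j == k)%:R.
  move=> ks js; rewrite LE; have [->|jk] := eqVneq j k.
    rewrite big1_seq// => m /andP[mk ms]; rewrite divff// subr_eq0.
    by apply: contra_neq mk => /ai ->.
  by rewrite (perm_big _ (perm_to_rem js))/= big_cons jk subrr mul0r mul0r.
(* Its degree is below [size s], yet it vanishes at the [size s] distinct nodes, so it is zero. *)
pose q : {poly F} := \sum_(k <- s) L k - 1.
have rq : all (root q) (map a s).
  apply/allP => _ /mapP[j js ->]; rewrite /root hornerD hornerN hornerC.
  rewrite horner_sum (perm_big _ (perm_to_rem js))/= big_cons Ls// eqxx.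
  rewrite big1_seq ?addr0 ?subrr// => m /= ms; rewrite Ls ?(mem_rem ms)//.
  by move: ms; rewrite mem_rem_uniq// inE => /andP[/negPf]; rewrite eq_sym => ->.
have sq : (size q <= size s)%N.
  rewrite (leq_trans (size_polyD _ _))// geq_max size_polyN size_poly1.
  (* The list must be nonempty here: the constant 1 has size 1. *)
  apply/andP; split; last by case: s k0s {us ai L LE szL Ls q rq}.
  rewrite big_seq; elim/big_ind : _ => //; first by rewrite size_poly0.
  by move=> p1 p2 sp1 sp2; rewrite (leq_trans (size_polyD _ _))// geq_max sp1.
have : q = 0.
  apply/eqP; rewrite -[_ == 0]negbK; apply/negP => q0.
  have := max_poly_roots q0 rq; rewrite map_inj_in_uniq// us size_map.
  by rewrite ltnNge sq => /(_ isT).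
move=> /(congr1 (horner^~ 0)); rewrite hornerD hornerN hornerC horner0.
move=> /eqP; rewrite subr_eq0 => /eqP sum1; rewrite -[RHS]sum1 horner_sum.
apply: eq_bigr => k _; rewrite LE; apply: eq_bigr => m _.
by rewrite sub0r -(opprB (a m)) invrN mulrNN.
Qed.

End lagrange.

(** * The exponential law of mean one *)

Section exponential_law.
Local Open Scope ereal_scope.
Context {d} {T : measurableType d} {R : realType} (P : probability T R)
  (X : T -> R).
Hypothesis mX : measurable_fun setT X.
Hypothesis Xexp : forall B : set R, measurable B ->
  P (X @^-1` B) = exponential_prob 1 B.

Notation mu := (@lebesgue_measure R).

Lemma ge0_integral_exponential (h : R -> \bar R) : measurable_fun setT h ->
  (forall x, 0 <= h x) ->
  \int[P]_w h (X w) = \int[mu]_x (h x * (exponential_pdf 1 x)%:E).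
Proof.
move=> mh h0.
pose X' : {mfun T >-> measurableTypeR R} :=
  HB.pack X (isMeasurableFun.Build _ _ _ (measurableTypeR R) X mX).
rewrite -(@ge0_integral_density _ _ _ mu (distribution P X') (exponential_pdf 1))//.
- by rewrite ge0_integral_distribution.
- exact: measurable_exponential_pdf.
- by move=> x; rewrite exponential_pdf_ge0.
Qed.

Lemma exponential_lt0 : P [set w | (X w < 0)%R] = 0.
Proof.
have -> : [set w | (X w < 0)%R] = X @^-1` `]-oo, 0%R[%classic.
  by apply/seteqP; split => w /=; rewrite in_itv.
rewrite Xexp// /exponential_prob integral0_eq// => x /=.
by rewrite in_itv/= => x0; rewrite lt0_exponential_pdf.
Qed.

(** Obtained by complement: the total mass is 1, the negative half-line has mass 0, and [[0, t]] has
    mass [1 - expR (- t)]. *)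
Lemma exponential_tail (t : R) : (0 <= t)%R ->
  P [set w | (t < X w)%R] = (expR (- t))%:E.
Proof.
move=> t0.
have -> : [set w | (t < X w)%R] = X @^-1` `]t, +oo[%classic.
  by apply/seteqP; split => w /=; rewrite in_itv/= andbT.
rewrite Xexp//.
have e1 : exponential_prob 1 [set: R] = 1.
  by rewrite /exponential_prob integral_exponential_pdf.
have e0 : exponential_prob 1 `]-oo, 0%R[%classic = 0 :> \bar R.
  rewrite /exponential_prob integral0_eq// => x /=.
  by rewrite in_itv/= => x0; rewrite lt0_exponential_pdf.
have et : exponential_prob 1 `[0%R, t]%classic = (1 - expR (- t))%:E.
  move: t0; rewrite le_eqVlt => /predU1P[<-|t0]; last first.
    by rewrite exponential_prob_itv0c// mulN1r.
  by rewrite oppr0 expR0 subrr set_itv1 /exponential_prob integral_set1.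
have adU A B : measurable A -> measurable B -> [disjoint A & B] ->
    exponential_prob 1 (A `|` B) =
    exponential_prob 1 A + exponential_prob 1 B :> \bar R.
  move=> mA mB AB; rewrite /exponential_prob ge0_integral_setU//.
    by apply/measurable_EFinP; apply: measurable_funTS; exact: measurable_exponential_pdf.
  by move=> x _; rewrite lee_fin exponential_pdf_ge0.
move: e1.
have -> : [set: R] = (`]-oo, 0%R[ `|` `[0%R, t]) `|` `]t, +oo[.
  apply/seteqP; split => x //= _; rewrite !in_itv/= andbT.
  by case: (ltP x 0%R) => x0; [left; left|case: (leP x t) => xt; [left; right|right]].
rewrite !adU//; last 3 first.
- apply/disj_setPS => x /=; rewrite !in_itv/= => -[x0 /andP[]].
  by rewrite leNgt x0.
- exact: measurableU.
- apply/disj_setPS => x /=; rewrite !in_itv/= andbT => -[[x0|/andP[_ xt]] tx].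
    by have := lt_trans tx x0; rewrite ltNge t0.
  by rewrite ltNge xt in tx.
rewrite e0 et add0e; case: (exponential_prob 1 `]t, +oo[%classic) => //= r.
by rewrite -EFinD => /eqP; rewrite eqe => /eqP rE; congr (_%:E); lra.
Qed.

(** This is the integral that appears when a tail of rate [a] is convolved with an exponential
    variable of rate [b], with [c = a / b]. The condition [c != 1] then says that the rates
    differ. *)
Lemma exponential_truncated_moment (c t : R) : c != 1%R -> (0 <= t)%R ->
  \int[P]_w (expR (c * X w) * \1_(`[0%R, t]%classic) (X w))%:E =
  ((1 - expR ((c - 1) * t)) / (1 - c))%:E.
Proof.
move=> c1 t0; have c10 : (c - 1 != 0)%R by rewrite subr_eq0.
have mec : measurable_fun setT (fun x : R => expR (c * x)).
  by apply: measurableT_comp => //; exact: measurable_funM.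
rewrite (@ge0_integral_exponential
    (fun x => (expR (c * x) * \1_(`[0%R, t]%classic) x)%:E)); last 2 first.
- by apply/measurable_EFinP; exact: measurable_funM.
- by move=> x; rewrite lee_fin mulr_ge0 ?expR_ge0.
transitivity (\int[mu]_(x in `[0%R, t]) (expR ((c - 1) * x))%:E).
  rewrite [RHS]integral_mkcond; apply: eq_integral => x _.
  rewrite patchE indicE; case: ifPn => [|_]; last by rewrite mulr0 mul0e.
  rewrite inE/= in_itv/= => /andP[x0 _]; rewrite mulr1 exponential_pdfE//.
  by rewrite mul1r mulN1r -EFinM -expRD mulrBl mul1r.
move: t0; rewrite le_eqVlt => /predU1P[<-|t0].
  by rewrite set_itv1 integral_set1 mulr0 expR0 subrr mul0r.
have dF (x : R) : is_derive x 1%R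
    (fun y : R => expR ((c - 1) * y) / (c - 1))%R (expR ((c - 1) * x)).
  apply: is_derive_eq.
  by rewrite /GRing.scale /= mulr1; field.
have cF : continuous (fun y : R => expR ((c - 1) * y) / (c - 1))%R.
  by move=> x; apply/differentiable_continuous/derivable1_diffP; exact: ex_derive.
rewrite (@continuous_FTC2 _ _ (fun y => expR ((c - 1) * y) / (c - 1))%R)//.
- rewrite -EFinB mulr0 expR0; congr (_%:E).
  have c11 : (1 - c != 0)%R by rewrite subr_eq0 eq_sym.
  by field; rewrite c10 c11.
- apply: continuous_subspaceT => x.
  by apply: continuous_comp; [exact: mulrl_continuous|exact: continuous_expR].
- split.
  + by move=> x _; exact: ex_derive.
  + by apply: cvg_at_right_filter; exact: cF.
  + by apply: cvg_at_left_filter; exact: cF.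
- by move=> x _; rewrite derive1E; exact: derive_val.
Qed.

End exponential_law.

(** * Tail of a sum of exponential variables with distinct rates *)

Section hypoexponential.
Local Open Scope ereal_scope.
Context {d} {T : measurableType d} {R : realType} (P : probability T R).

(** Integrate over [V] first. If [V / b] exceeds [t] the event is almost sure, since [Y] is almost
    surely nonnegative; otherwise its probability is the tail of [Y] at [t - V / b]. The weights
    stay abstract, as the induction on the number of summands needs only the shape of the tail. *)
Lemma exponential_convolution_tail {I : Type} (s : seq I) (Y V : T -> R)
    (b : R) (a weight : I -> R) (t : R) :
  measurable_fun setT Y -> measurable_fun setT V ->
  (forall A B, measurable A -> measurable B ->
    P (V @^-1` A `&` Y @^-1` B) = P (V @^-1` A) * P (Y @^-1` B)) ->
  (forall B : set R, measurable B -> P (V @^-1` B) = exponential_prob 1 B) ->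
  (forall tau, 0 <= tau -> P [set w | tau < Y w] =
    (\sum_(k <- s) weight k * expR (- (a k * tau)))%:E)%R ->
  (forall tau, (tau < 0)%R -> P [set w | (tau < Y w)%R] = 1) ->
  (0 < b)%R -> (forall k, a k != b) -> (0 <= t)%R ->
  P [set w | (t < V w / b + Y w)%R] =
  (expR (- (b * t)) + \sum_(k <- s) weight k * (b / (b - a k)) *
    (expR (- (a k * t)) - expR (- (b * t))))%:E.
Proof.
move=> mY mV VY Vexp tailY tailY0 b0 ab t0.
pose D := [set z : R * R | (t < z.1 / b + z.2)%R].
have mVb : measurable_fun setT (fun w => V w / b)%R by exact: measurable_funM.
have mD : measurable D.
  apply: measurable_set_ltr => //; apply: measurable_funD => //.
  exact: measurable_funM.
have mf : measurable_fun setT (fun z => (\1_D z)%:E : \bar R).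
  exact/measurable_EFinP.
transitivity (\int[P]_w (\1_D (V w, Y w))%:E).
  rewrite (_ : (fun w => _) = (fun w => (\1_[set w | t < V w / b + Y w]%R w)%:E))//.
  rewrite integral_indic ?setIT//.
  by apply: measurable_set_ltr => //; exact: measurable_funD.
rewrite (ge0_integral_independent mV mY VY mf)//.
have inner w : \int[P]_w2 (\1_D (V w, Y w2))%:E =
    P [set w2 | (t - V w / b < Y w2)%R].
  rewrite (_ : (fun w2 => _) =
      (fun w2 => (\1_[set w2 | t - V w / b < Y w2]%R w2)%:E)); last first.
    apply/funext => w2; rewrite !indicE; congr (_%:R%:E); congr (nat_of_bool _).
    by apply/idP/idP; rewrite !inE/= ltrBlDl.
  by rewrite integral_indic ?setIT//; exact: measurable_set_ltr.
have minner : measurable_fun setT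
    (fun w => \int[P]_w2 (\1_D (V w, Y w2))%:E).
  apply: (measurable_fun_fubini_tonelli_F (m2 := P)
    (fun z : T * T => (\1_D (V z.1, Y z.2))%:E)) => //.
  by apply: (measurableT_comp mf); apply: measurable_fun_pair; exact: measurableT_comp.
pose c k := (a k / b)%R.
pose g k w := (expR (c k * V w) * \1_(`[0%R, (b * t)%R]%classic) (V w))%R.
pose h w := (\1_(`](b * t)%R, +oo[%classic) (V w) : R)%R.
have bt0 : (0 <= b * t)%R by rewrite mulr_ge0// ltW.
have mg k : measurable_fun setT (g k).
  apply: measurable_funM; last exact: measurableT_comp.
  by apply: measurableT_comp => //; exact: measurable_funM.
have mh : measurable_fun setT h by exact: measurableT_comp.
have c1 k : (c k != 1)%R.
  by apply: contra_neq (ab k) => /(congr1 ( *%R ^~ b)); rewrite divfK ?mul1r// gt_eqF.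
have intg k : \int[P]_w (g k w)%:E =
    ((1 - expR ((c k - 1) * (b * t))) / (1 - c k))%:E.
  by rewrite (exponential_truncated_moment mV Vexp).
have ig k : P.-integrable setT (EFin \o g k).
  apply/integrableP; split; first exact/measurable_EFinP.
  under eq_integral do rewrite /= ger0_norm ?mulr_ge0 ?expR_ge0//.
  by rewrite intg ltry.
have ih : P.-integrable setT (EFin \o h).
  apply: (@le_integrable _ _ _ _ _ measurableT _ (cst 1)) => //.
  - exact/measurable_EFinP.
  - by move=> w _; rewrite /= lee_fin /h indicE normr1;
      case: (_ \in _); rewrite ?normr1 ?normr0.
  - exact: finite_measure_integrable_cst.
have inth : \int[P]_w (h w)%:E = (expR (- (b * t)))%:E.
  rewrite -(exponential_tail Vexp bt0).
  rewrite (_ : (fun w => _) = (fun w => (\1_[set w | b * t < V w]%R w)%:E)).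
    by rewrite integral_indic ?setIT//; exact: measurable_set_ltr.
  apply/funext => w; rewrite /h !indicE; congr (_%:R%:E); congr (nat_of_bool _).
  by apply/idP/idP; rewrite !inE/= in_itv/= andbT.
(* The inner probability on [V >= 0]: [h] covers [V > b * t], and the terms in [g k] cover
   [0 <= V <= b * t]. *)
pose F w := (h w)%:E + \sum_(k <- s) ((weight k * expR (- (a k * t)))%:E * (g k w)%:E).
(* Equality holds only almost everywhere: for negative [V] the function [F] is 0 while the inner
   probability need not be. *)
have -> : \int[P]_w1 \int[P]_w2 (\1_D (V w1, Y w2))%:E = \int[P]_w F w.
  apply: ae_eq_integral => //.
  - apply: emeasurable_funD; first exact/measurable_EFinP.
    apply: emeasurable_sum => k; apply: emeasurable_funM => //.
    exact/measurable_EFinP.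
  - exists [set w | (V w < 0)%R]; split.
    + exact: measurable_set_ltr.
    + exact: exponential_lt0.
    + move=> w /= Hw; apply: contrapT => /negP; rewrite -leNgt => V0.
      apply: Hw => _; rewrite inner /F.
      have [Vb|bV] := leP (V w) (b * t)%R.
        have -> : h w = 0%R.
          by rewrite /h indicE memNset//= in_itv/= andbT; apply/negP; rewrite -leNgt.
        rewrite add0e tailY; last first.
          by rewrite subr_ge0 ler_pdivrMr// mulrC.
        rewrite -sumEFin; apply: eq_bigr => k _; rewrite -EFinM; congr (_%:E).
        rewrite /g indicE mem_set; last by rewrite /= in_itv/= V0.
        rewrite mulr1 -mulrA -expRD; congr (_ * expR _)%R.
        by rewrite /c; field; rewrite gt_eqF.
      rewrite tailY0; last by rewrite subr_lt0 ltr_pdivlMr// mulrC.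
      rewrite /h indicE mem_set; last by rewrite /= in_itv/= bV.
      rewrite big1 ?adde0// => k _; rewrite /g indicE memNset ?mulr0 ?mule0//.
      by rewrite /= in_itv/= => /andP[_]; rewrite leNgt bV.
have isum k : P.-integrable setT
    (fun w => (weight k * expR (- (a k * t)))%:E * (g k w)%:E).
  exact: (integrableZl measurableT _ (ig k)).
rewrite /F integralD//; last by apply: integrable_sum.
rewrite inth integral_sum//.
have intk k : \int[P]_w ((weight k * expR (- (a k * t)))%:E * (g k w)%:E) =
    (weight k * (b / (b - a k)) * (expR (- (a k * t)) - expR (- (b * t))))%:E.
  rewrite (integralZl measurableT (ig k)) /= intg -EFinM; congr (_%:E).
  have -> : (expR ((c k - 1) * (b * t)) = expR (a k * t) * expR (- (b * t)))%R.
    by rewrite -expRD; congr expR; rewrite /c; field; rewrite gt_eqF.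
  have -> : ((1 - expR (a k * t) * expR (- (b * t))) / (1 - c k) =
      b / (b - a k) * (1 - expR (a k * t) * expR (- (b * t))))%R.
    have bak : (b - a k != 0)%R by rewrite subr_eq0 eq_sym.
    by rewrite /c; field; rewrite bak gt_eqF.
  have ea : (expR (- (a k * t)) * expR (a k * t) = 1)%R by rewrite -expRD addNr expR0.
  rewrite -!mulrA; congr (_ * _)%R; rewrite mulrCA; congr (_ * _)%R.
  by rewrite mulrCA mulrBr mulr1 mulrA ea mul1r.
by under eq_bigr do rewrite intk; rewrite sumEFin -EFinD.
Qed.

Context {I : eqType} (X : I -> T -> R).
Hypothesis mX : forall i, measurable_fun setT (X i).
Hypothesis XI : mutually_independent P X.
Hypothesis Xexp : forall i (B : set R), measurable B ->
  P (X i @^-1` B) = exponential_prob 1 B.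

Let measurable_weighted_sum (s : seq I) (a : I -> R) :
  measurable_fun setT (fun w => \sum_(k <- s) X k w / a k)%R.
Proof.
by apply: measurable_sum => k; exact: measurable_funM.
Qed.

Lemma weighted_exponential_sum_lt0 (s : seq I) (a : I -> R) :
  {in s, forall k, 0 < a k}%R ->
  P [set w | (\sum_(k <- s) X k w / a k < 0)%R] = 0.
Proof.
elim: s => [_|k0 s IH a0].
  rewrite [X in P X](_ : _ = set0) ?measure0//.
  by apply/seteqP; split => // w /=; rewrite big_nil ltxx.
have m1 : measurable [set w | (X k0 w < 0)%R] by exact: measurable_set_ltr.
have m2 : measurable [set w | (\sum_(k <- s) X k w / a k < 0)%R].
  exact: measurable_set_ltr.
apply/eqP; rewrite eq_le measure_ge0 andbT.
rewrite (@le_trans _ _ (P ([set w | (X k0 w < 0)%R] `|`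
  [set w | (\sum_(k <- s) X k w / a k < 0)%R])))//.
  rewrite le_measure ?inE//; [exact: measurable_set_ltr|exact: measurableU|].
  move=> w /=; rewrite big_cons => Hw.
  have [|Y0] := ltP (\sum_(j <- s) X j w / a j)%R 0%R; first by right.
  left; rewrite ltNge; apply/negP => X0; move: Hw; rewrite ltNge addr_ge0//.
  by rewrite divr_ge0// ltW// a0// mem_head.
apply: (le_trans (measureU2 _ m1 m2)).
rewrite [X in X + _](exponential_lt0 (Xexp k0)) add0e [X in X <= _]IH//.
by move=> k ks; rewrite a0// inE ks orbT.
Qed.

(** Adding a variable of rate [b] multiplies each old weight by [b / (b - a k)], which is the factor
    expected from the product. The weight of the new exponential is whatever remains of 1, and the
    Lagrange identity identifies it. *)
Lemma hypoexponential_tail (s : seq I) (a : I -> R) (t : R) :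
  uniq s -> {in s, forall k, 0 < a k}%R -> {in s &, injective a} ->
  (0 <= t)%R ->
  P [set w | (t < \sum_(k <- s) X k w / a k)%R] =
  (\sum_(k <- s) (\prod_(m <- s | m != k) (a m / (a m - a k))) *
     expR (- (a k * t)))%:E.
Proof.
elim: s t => [t _ _ _ t0|k0 s IH t].
  rewrite big_nil [X in P X](_ : _ = set0) ?measure0//.
  by apply/seteqP; split => // w /=; rewrite big_nil ltNge t0.
move=> us a0 ai t0; move: (us) => /= /andP[k0s us'].
have a0' : {in s, forall k, 0 < a k}%R by move=> k ks; rewrite a0// inE ks orbT.
have ai' : {in s &, injective a}.
  by move=> k l ks ls; apply: ai; rewrite inE ?ks ?ls orbT.
pose b := a k0; have b0 : (0 < b)%R by rewrite a0// mem_head.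
have ab k : k \in s -> a k != b.
  move=> ks; apply/negP => /eqP /ai; rewrite mem_head inE ks orbT => /(_ isT isT).
  by move=> kk0; move: k0s; rewrite -kk0 ks.
(* The convolution step wants rates different from [b] at every index; off [s] the value [b + 1] is
   a dummy. *)
pose a' k := if k \in s then a k else (b + 1)%R.
have ab' k : a' k != b.
  rewrite /a'; case: ifPn => [/ab//|_]; rewrite -subr_eq0 addrAC subrr add0r.
  exact: oner_neq0.
pose weight k := (\prod_(m <- s | m != k) (a m / (a m - a k)))%R.
pose Y w := (\sum_(k <- s) X k w / a k)%R.
have mY : measurable_fun setT Y by exact: measurable_weighted_sum.
have VY A B : measurable A -> measurable B ->
    P (X k0 @^-1` A `&` Y @^-1` B) = P (X k0 @^-1` A) * P (Y @^-1` B).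
  have KL : [set k0] `&` [set` s] = set0.
    by apply/seteqP; split => // k /= [->]; rewrite (negPf k0s).
  move=> mA mB; apply: (independent_sigma_over mX XI KL).
    have := @measurable_sigma_over _ _ _ _ _ X [set k0] k0 erefl.
    by move=> /(_ measurableT _ mA); rewrite setTI.
  pose TK := g_sigma_algebraType (preimages_over X [set` s]).
  suff : measurable_fun setT (Y : TK -> R).
    by move=> /(_ measurableT _ mB); rewrite setTI.
  (* Only the variables indexed by [s] are known to be measurable for the sigma-algebra of [TK], so
     the other indices get a constant summand. *)
  apply: (eq_measurable_fun (fun w : TK =>
    \sum_(k <- s) (if k \in s then X k w / a k else 0))%R).
    by move=> w _; rewrite /Y !big_seq; apply: eq_bigr => k ->.
  apply: (measurable_sum (T := TK)) => k; case: (boolP (k \in s)) => // ks.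
  apply: measurable_funM => //.
  exact: (@measurable_sigma_over _ _ _ _ _ X [set` s] k ks).
have tailY tau : (0 <= tau -> P [set w | tau < Y w] =
    (\sum_(k <- s) weight k * expR (- (a' k * tau)))%:E)%R.
  move=> tau0; rewrite IH//; congr (_%:E).
  by rewrite !big_seq; apply: eq_bigr => k ks; rewrite /a' ks.
have tailY0 tau : (tau < 0)%R -> P [set w | (tau < Y w)%R] = 1.
  move=> tau0.
  have mYn : measurable [set w | (Y w < 0)%R] by exact: measurable_set_ltr.
  have mYt : measurable [set w | (tau < Y w)%R] by exact: measurable_set_ltr.
  apply/eqP; rewrite eq_le probability_le1//=.
  rewrite (@le_trans _ _ (P (~` [set w | (Y w < 0)%R])))//.
    by rewrite probability_setC// [X in _ - X](weighted_exponential_sum_lt0 a0') sube0.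
  rewrite le_measure ?inE//; first exact: measurableC.
  by move=> w /= /negP; rewrite -leNgt; exact: lt_le_trans.
rewrite (_ : [set w | (t < \sum_(k <- k0 :: s) X k w / a k)%R] =
  [set w | (t < X k0 w / b + Y w)%R]); last first.
  by apply/seteqP; split => w /=; rewrite big_cons.
rewrite (exponential_convolution_tail mY (mX k0) VY (Xexp k0) tailY tailY0 b0 ab' t0).
congr (_%:E); rewrite big_cons big_cons/= eqxx/=.
have wE k : k \in s -> (\prod_(m <- k0 :: s | m != k) (a m / (a m - a k)) =
    b / (b - a k) * weight k)%R.
  move=> ks; rewrite big_cons ifT//.
  by apply: contraNneq k0s => ->.
rewrite (_ : (\sum_(k <- s) (\prod_(m <- k0 :: s | m != k) (a m / (a m - a k))) *
    expR (- (a k * t)) = \sum_(k <- s) (weight k * (b / (b - a' k))) *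
    expR (- (a' k * t)))%R); last first.
  rewrite !big_seq; apply: eq_bigr => k ks; rewrite wE// /a' ks; congr (_ * _)%R.
  by rewrite mulrC.
(* So far [expR (- (b * t))] has the coefficient 1 minus the sum of the other weights; this turns it
   into the product attached to [k0]. *)
have := sum_lagrange_weights (mem_head k0 s) us ai.
rewrite big_cons big_cons/= eqxx/=.
rewrite (_ : (\sum_(k <- s) (\prod_(m <- k0 :: s | m != k) (a m / (a m - a k))) =
    \sum_(k <- s) (weight k * (b / (b - a' k))))%R); last first.
  by rewrite !big_seq; apply: eq_bigr => k ks; rewrite wE// /a' ks mulrC.
move=> /esym/eqP; rewrite -subr_eq => /eqP <-.
under eq_bigr do rewrite mulrBr.
by rewrite sumrB -mulr_suml -/b; ring.
Qed.

End hypoexponential.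

(** * Laplace functional of a Poisson process *)

Section laplace_kernel.
Context {R : realType}.

(* exp (- x) for x in [0, +oo]; the value 1 at -oo is junk. *)
Definition expNe (x : \bar R) : R := if (x < +oo)%E then expR (- fine x) else 0.

Lemma expNe_EFin r : expNe r%:E = expR (- r).
Proof. by rewrite /expNe ltry. Qed.

Lemma expNe_ge0 x : 0 <= expNe x.
Proof. by rewrite /expNe; case: ifP => // _; exact: expR_ge0. Qed.

Lemma expNe_le1 x : (0 <= x)%E -> expNe x <= 1.
Proof.
by rewrite /expNe => x0; case: ifP => // _; rewrite -expR0 ler_expR lerNl oppr0 fine_ge0.
Qed.

Lemma expNeD x y : (0 <= x)%E -> (0 <= y)%E -> expNe (x + y) = expNe x * expNe y.
Proof.
case: x => [x| |]//; case: y => [y| |]// _ _; rewrite ?addey ?addye//.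
- by rewrite -EFinD !expNe_EFin opprD expRD.
- by rewrite /expNe ltxx mulr0.
- by rewrite /expNe ltxx mul0r.
- by rewrite /expNe ltxx mul0r.
Qed.

Lemma expNe_sum {I : Type} (s : seq I) (f : I -> \bar R) :
  (forall i, 0 <= f i)%E ->
  expNe (\sum_(i <- s) f i)%E = \prod_(i <- s) expNe (f i).
Proof.
move=> f0; elim: s => [|i s IH]; first by rewrite !big_nil expNe_EFin oppr0 expR0.
by rewrite !big_cons expNeD ?IH// sume_ge0.
Qed.

Lemma measurable_expNe : measurable_fun setT expNe.
Proof.
apply: measurable_fun_ifT => //.
- exact: measurable_fun_lte.
- do 2 apply: measurableT_comp => //; exact: fine_measurable.
Qed.

(** Continuity at [+oo] is what matters: partial sums over the points of a realisation may diverge,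
    and the product of escape probabilities then tends to 0. *)
Lemma cvg_expNe (u : (\bar R)^nat) (l : \bar R) : (forall n, 0 <= u n)%E ->
  u @ \oo --> l -> expNe (u n) @[n --> \oo] --> expNe l.
Proof.
move=> u0; case: l => [r| |] ul.
- have /fine_cvgP[fu ur] := ul.
  have : expR (- fine (u n)) @[n --> \oo] --> expR (- r).
    apply: (@cvg_comp _ _ _ (fun n => - fine (u n)) expR _ (nbhs (- r))).
      exact: cvgN.
    exact: continuous_expR.
  rewrite expNe_EFin; apply: cvg_trans; apply: near_eq_cvg.
  near=> n; rewrite /expNe ifT//.
  suff /fineK <- : u n \is a fin_num by rewrite ltry.
  by near: n.
- rewrite [expNe +oo%E]/expNe ltxx.
  have /cvgeyPge uy := ul.
  apply/cvgrPdist_le => e e0.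
  have := uy (- ln e); apply: filterS => n.
  rewrite sub0r normrN ger0_norm ?expNe_ge0// /expNe.
  case: (u n) => [x| |]//=; rewrite ?ltxx ?(ltW e0)//.
  by rewrite ltry lee_fin lerNl -ler_expR lnK.
- exfalso.
  have /cvgeNyPle/(_ (-1)%R)[n _ /(_ n (leqnn n))/= un] := ul.
  by have := le_trans (u0 n) un; rewrite lee_fin ler0N1.
Unshelve. all: by end_near. Qed.

End laplace_kernel.

Section product_expectation.
Local Open Scope ereal_scope.
Context {d d'} {T : measurableType d} {S : measurableType d'} {R : realType}
  (P : probability T R) {I : eqType} (X : I -> T -> S) (f : I -> S -> R).
Hypothesis mX : forall i, measurable_fun setT (X i).
Hypothesis XI : mutually_independent P X.
Hypothesis mf : forall i, measurable_fun setT (f i).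
Hypothesis f0 : forall i x, (0 <= f i x)%R.

(** One factor is peeled off at a time; the others together are a function of the identity into the
    sigma-algebra of the remaining indices, which is independent of [X k]. *)
Lemma integral_prod_independent (s : seq I) : uniq s ->
  \int[P]_w (\prod_(i <- s) f i (X i w))%:E =
  \prod_(i <- s) \int[P]_w (f i (X i w))%:E.
Proof.
elim: s => [_|k s IH /= /andP[ks us]].
  rewrite big_nil; under eq_integral do rewrite big_nil.
  by rewrite integral_cst// mul1e; exact: probability_setT.
rewrite big_cons -IH//; under eq_integral do rewrite big_cons.
pose TK := g_sigma_algebraType (preimages_over X [set` s]).
pose F w := (\prod_(i <- s) f i (X i w))%R.
have mF : measurable_fun setT (F : TK -> R).
  apply: (eq_measurable_fun (fun w : TK =>
    \prod_(i <- s) (if i \in s then f i (X i w) else 1))%R).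
    by move=> w _; rewrite /F !big_seq; apply: eq_bigr => i ->.
  apply: (measurable_prod (T := TK)) => i _; case: (boolP (i \in s)) => // si.
  apply: measurableT_comp => //.
  exact: (@measurable_sigma_over _ _ _ _ _ X [set` s] i si).
have KL : [set k] `&` [set` s] = set0.
  by apply/seteqP; split => // i /= [->]; rewrite (negPf ks).
have XF A B : measurable A -> measurable B ->
    P (X k @^-1` A `&` (id : T -> TK) @^-1` B) =
    P (X k @^-1` A) * P ((id : T -> TK) @^-1` B).
  move=> mA mB; apply: (independent_sigma_over mX XI KL) => //.
  have := @measurable_sigma_over _ _ _ _ _ X [set k] k erefl.
  by move=> /(_ measurableT _ mA); rewrite setTI.
have mid : measurable_fun setT (id : T -> TK).
  exact: measurable_id_sigma_over.
have F0 w : (0 <= F w)%R by apply: prodr_ge0.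
rewrite (ge0_integral_independent (f := fun z : S * TK => (f k z.1 * F z.2)%:E)
  (mX k) mid XF); last 2 first.
- apply/measurable_EFinP; apply: measurable_funM; first exact: measurableT_comp.
  exact: measurableT_comp.
- by move=> z; rewrite lee_fin mulr_ge0.
rewrite /= (_ : (fun w1 => _) = (fun w1 => (f k (X k w1))%:E * \int[P]_w (F w)%:E)).
  rewrite ge0_integralZr//.
  - by apply/measurable_EFinP; exact: measurableT_comp.
  - by move=> w _; rewrite lee_fin.
  - by apply: integral_ge0 => w _; rewrite lee_fin.
apply/funext => w1; under eq_integral do rewrite EFinM.
rewrite ge0_integralZl//.
- apply/measurable_EFinP => _ B mB; have := mF measurableT B mB.
  by rewrite !setTI; apply: sigma_over_measurable.
- by move=> w _; rewrite lee_fin.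
- by rewrite lee_fin.
Qed.

End product_expectation.

Section poisson_generating_function.
Local Open Scope ereal_scope.
Context {d} {T : measurableType d} {R : realType} (P : probability T R).

Lemma sum_poisson_laplace (r y : R) : (0 <= r)%R ->
  \sum_(0 <= n <oo) ((expR (- (y * n%:R)))%:E * poisson_prob r 0 [set n]) =
  (expR (- (r * (1 - expR (- y)))))%:E.
Proof.
rewrite le_eqVlt => /predU1P[<-|r0].
  (* At rate 0 the law [poisson_prob] is the Dirac mass at 0, so only the term [n = 0] survives. *)
  rewrite (@nneseriesD1 _ _ 0%N)//; last first.
    by move=> n _; rewrite mule_ge0 ?lee_fin ?expR_ge0// measure_ge0.
  rewrite mulr0 oppr0 expR0 mul0r oppr0 expR0 mul1e eseries0 ?adde0.
    by rewrite /poisson_prob ltxx diracE mem_set.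
  move=> n _ /= n0; rewrite /poisson_prob ltxx diracE memNset ?mule0//=.
  by move=> n00; move: n0; rewrite -n00.
(* Exponential tilting: the factor [expR (- y) ^+ n] turns the weights of rate [r] into those of
   rate [q], up to a constant, and the latter sum to 1. *)
pose q := (r * expR (- y))%R.
have q0 : (0 < q)%R by rewrite mulr_gt0// expR_gt0.
have prob1 n (s : R) : (0 < s)%R -> poisson_prob s 0 [set n] = (poisson_pmf s n)%:E.
  by move=> s0; rewrite /poisson_prob s0 esum_set1// lee_fin poisson_pmf_ge0.
have pmfE n : (expR (- (y * n%:R)) * poisson_pmf r n =
    expR (- (r * (1 - expR (- y)))) * poisson_pmf q n)%R.
  rewrite /poisson_pmf r0 q0 /q exprMn.
  have -> : (expR (- (y * n%:R)) = expR (- y) ^+ n)%R.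
    by rewrite -expRM_natr mulNr.
  have -> : (expR (- r) = expR (- (r * (1 - expR (- y)))) * expR (- (r * expR (- y))))%R.
    by rewrite -expRD; congr expR; ring.
  by ring.
under eq_eseriesr.
  move=> n _; rewrite prob1// -EFinM pmfE.
  rewrite EFinM; over.
rewrite nneseriesZl/=; last by move=> n _; rewrite lee_fin poisson_pmf_ge0.
rewrite nneseries_esumT; last by move=> n; rewrite lee_fin poisson_pmf_ge0.
have : poisson_prob q 0 [set: nat] = 1 :> \bar R by exact: probability_setT.
by rewrite {1}/poisson_prob q0 => ->; rewrite mule1.
Qed.

Lemma poisson_laplace (N : T -> \bar R) (r y : R) : (0 <= r)%R -> (0 <= y)%R ->
  measurable_fun setT N ->
  (forall n, P [set w | N w = n%:R%:E] = poisson_prob r 0 [set n]) ->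
  \int[P]_w (expNe (y%:E * N w))%:E = (expR (- (r * (1 - expR (- y)))))%:E.
Proof.
move=> r0 y0 mN NP.
pose F n := [set w | N w = n%:R%:E].
have mF n : measurable (F n).
  have := mN measurableT [set n%:R%:E] (emeasurable_set1 _).
  by rewrite setTI.
have tF : trivIset setT F.
  apply/trivIsetP => m n _ _ mn; apply/seteqP; split => // w [Fm Fn].
  have [/eqP] : m%:R%:E = n%:R%:E :> \bar R by rewrite -Fm -Fn.
  by rewrite eqr_nat (negPf mn).
have mU : measurable (\bigcup_n F n) by exact: bigcup_measurable.
(* The variable [N] takes extended real values; since the Poisson weights sum to 1, it is almost
   surely a natural number. *)
have PU : P (\bigcup_n F n) = 1.
  transitivity (\sum_(0 <= n <oo) poisson_prob r 0 [set n]).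
    by rewrite measure_semi_bigcup//; apply: eq_eseriesr => n _; exact: NP.
  rewrite -(probability_setT (poisson_prob r 0)).
  rewrite (_ : [set: nat] = \bigcup_n [set n]); last first.
    by apply/seteqP; split => // n _; exists n.
  rewrite measure_semi_bigcup//.
  by apply/trivIsetP => m n _ _ mn; apply/seteqP; split => // x [/= -> /eqP];
    rewrite (negPf mn).
have PN : P (~` \bigcup_n F n) = 0 by rewrite probability_setC// [X in _ - X]PU subee.
have mg : measurable_fun setT (fun w => (expNe (y%:E * N w))%:E : \bar R).
  apply/measurable_EFinP; apply: (measurableT_comp measurable_expNe).
  exact: emeasurable_funM.
have g0 w : 0 <= (expNe (y%:E * N w))%:E by rewrite lee_fin expNe_ge0.
rewrite -(setUv (\bigcup_n F n)) ge0_integral_setU//; last 3 first.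
- exact: measurableC.
- by rewrite setUv.
- by apply/disj_setPCl.
rewrite [X in _ + X]null_set_integral//; last 2 first.
- exact: measurableC.
- exact: measurable_funS mg.
rewrite adde0 ge0_integral_bigcup//; last exact: measurable_funS mg.
rewrite -sum_poisson_laplace//; apply: eq_eseriesr => n _.
under eq_integral.
  move=> w; rewrite inE => ->; rewrite -EFinM expNe_EFin; over.
by rewrite /= integral_cst//; congr (_ * _); exact: NP.
Qed.

End poisson_generating_function.

(** * Simple functions: finitely many independent Poisson counts *)

Section laplace_functional.
Local Open Scope ereal_scope.
Context {d} {T : measurableType d} {R : realType} (P : probability T R).
Variables (lambda : R) (E : nat -> {RV P >-> plane R}).
Hypothesis lambda_ge0 : (0 <= lambda)%R.
Hypothesis E_poisson : homogeneous_poisson_process lambda E.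

Lemma measurable_point_count (B : set (plane R)) : measurable B ->
  measurable_fun setT (fun w => point_count (fun j => E j) B w).
Proof.
move=> mB; apply: ge0_emeasurable_sum => // j _.
rewrite (_ : (fun w => _) = (fun w => (\1_(E j @^-1` B) w)%:E)) //.
apply/measurable_EFinP; apply: measurable_indic.
by rewrite -[X in measurable X]setTI; exact: measurable_funP.
Qed.

Lemma sum_uniq_indicator (s : seq R) (G : R -> R) (z : R) : uniq s ->
  (\sum_(y <- s) G y * (z == y)%:R = if z \in s then G z else 0)%R.
Proof.
move=> us; case: ifPn => zs.
  rewrite (bigD1_seq z)//= eqxx mulr1 big1 ?addr0// => y yz.
  by rewrite eq_sym (negPf yz) mulr0.
rewrite big_seq big1// => y ys; case: eqP => [zy|]; last by rewrite mulr0.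
by rewrite zy ys in zs.
Qed.

Import HBNNSimple.

(** The sum over the points is a combination of the counts of the level sets of [h]. These are
    disjoint, so the counts are independent and the expectation splits into one-variable Poisson
    transforms. *)
Lemma poisson_laplace_nnsfun (h : {nnsfun plane R >-> R}) :
  (forall y, y != 0%R -> area (h @^-1` [set y]) < +oo) ->
  \int[P]_w (expNe (\sum_(0 <= j <oo) (h (E j w))%:E))%:E =
  (expR (- (lambda * fine (\int[area]_x (1 - expR (- h x))%:E))))%:E.
Proof.
move=> hfin.
have /finite_seqP[s' rs] : finite_set (range h) by [].
(* The value 0 contributes nothing to the sum, and its level set has infinite area, so it must be
   left out. *)
pose s := [seq y <- undup s' | y != 0%R].
have us : uniq s by rewrite filter_uniq// undup_uniq.
have hs x : h x != 0%R -> h x \in s.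
  move=> hx; rewrite mem_filter hx/= mem_undup.
  suff : [set` s'] (h x) by []. by rewrite -rs; exists x.
have s0 y : y \in s -> (0 < y)%R.
  rewrite mem_filter mem_undup => /andP[y0 ys].
  have [x _ xy] : range h y by rewrite rs.
  by rewrite lt_neqAle eq_sym y0 -xy fun_ge0.
have sn0 y : y \in s -> y != 0%R by move=> /s0; rewrite lt_neqAle eq_sym => /andP[].
pose B y : set (plane R) := h @^-1` [set y].
have mB y : measurable (B y) by exact: measurable_sfunP.
have dE x y : \d_x (B y) = (h x == y)%:R%:E :> \bar R.
  rewrite diracE; congr (_%:R%:E); congr nat_of_bool.
  by apply/idP/eqP; rewrite inE.
have hE x : h x = (\sum_(y <- s) y * (h x == y)%:R)%R.
  rewrite (sum_uniq_indicator id)//; case: ifPn => // hx.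
  by apply/eqP/contraT => /hs; rewrite (negPf hx).
have gE x : (1 - expR (- h x) = \sum_(y <- s) (1 - expR (- y)) * (h x == y)%:R)%R.
  rewrite (sum_uniq_indicator (fun y => 1 - expR (- y))%R)//; case: ifPn => // hx.
  have -> : h x = 0%R by apply/eqP/contraT => /hs; rewrite (negPf hx).
  by rewrite oppr0 expR0 subrr.
pose N y w := point_count (fun j => E j) (B y) w.
have NE w : \sum_(0 <= j <oo) (h (E j w))%:E = \sum_(y <- s) (y%:E * N y w).
  transitivity (\sum_(0 <= j <oo) \sum_(y <- s) y%:E * \d_(E j w) (B y)).
    apply: eq_eseriesr => j _; rewrite {1}hE -sumEFin; apply: eq_bigr => y _.
    by rewrite dE EFinM.
  transitivity (\sum_(0 <= j <oo) \sum_(y <- s | y \in s) y%:E * \d_(E j w) (B y)).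
    by apply: eq_eseriesr => j _; rewrite big_seq.
  rewrite nneseries_sum; last first.
    by move=> y j ys; rewrite mule_ge0// lee_fin ltW// s0.
  rewrite [RHS]big_seq; apply: eq_bigr => y ys.
  by rewrite nneseriesZl.
(* The Poisson hypothesis speaks of families of sets indexed by ordinals. *)
pose y_ (i : 'I_(size s)) := tnth (in_tuple s) i.
have ys i : y_ i \in s by exact: mem_tnth.
have yinj : injective y_.
  by move=> i j /eqP; rewrite /y_ !(tnth_nth 0%R)/= nth_uniq// => /eqP/val_inj.
have tB : trivIset setT (fun i => B (y_ i)).
  apply/trivIsetP => i j _ _ ij; apply/seteqP; split => // x [xi xj].
  have /yinj/eqP : y_ i = y_ j by rewrite -xi -xj.
  by rewrite (negPf ij).
have [Ecount Eind] := E_poisson.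
under [LHS]eq_integral.
  move=> w _; rewrite NE big_tnth expNe_sum; last first.
    by move=> i; rewrite mule_ge0 ?lee_fin ?(ltW (s0 _ (ys i)))// nneseries_ge0.
  over.
have mN i : measurable_fun setT (fun w => N (y_ i) w).
  exact: measurable_point_count.
have me i : measurable_fun setT (fun x : \bar R => expNe ((y_ i)%:E * x)).
  by apply: (measurableT_comp measurable_expNe); exact: emeasurable_funM.
have IP := integral_prod_independent (X := fun i w => N (y_ i) w)
  (f := fun i x => expNe ((y_ i)%:E * x)) mN
  (Eind _ (fun i => B (y_ i)) (fun i => mB (y_ i)) tB) me (fun i x => expNe_ge0 _)
  (index_enum_uniq _).
rewrite /= IP {IP}.
have PL i : \int[P]_w (expNe ((y_ i)%:E * N (y_ i) w))%:E =
    (expR (- (lambda * fine (area (B (y_ i))) * (1 - expR (- y_ i)))))%:E.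
  apply: poisson_laplace => //.
  - by rewrite mulr_ge0// fine_ge0.
  - exact/ltW/s0.
  - by move=> n; apply: Ecount => //; apply: hfin; exact: sn0.
under eq_bigr do rewrite PL.
rewrite prodEFin -expR_sum; congr (expR _)%:E.
rewrite sumrN; congr (- _)%R.
have areaE : \int[area]_x (1 - expR (- h x))%:E =
    (\sum_(y <- s) (1 - expR (- y)) * fine (area (B y)))%:E.
  pose f y x : \bar R := ((if y \in s then 1 - expR (- y) else 0) * (h x == y)%:R)%:E.
  transitivity (\int[area]_x \sum_(y <- s) f y x).
    apply: eq_integral => x _; rewrite gE /f sumEFin; congr (_%:E).
    by rewrite !big_seq; apply: eq_bigr => y ->.
  have fE y : f y = (fun x => ((if y \in s then 1 - expR (- y) else 0) * \1_(B y) x)%:E).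
    apply/funext => x; rewrite /f indicE; congr (_ * _%:R)%:E; congr nat_of_bool.
    by apply/eqP/idP; rewrite inE.
  have c0 y : (0 <= if y \in s then 1 - expR (- y) else 0)%R.
    by case: ifPn => // /s0 y0; rewrite subr_ge0 -expR0 ler_expR lerNl oppr0 ltW.
  rewrite ge0_integral_sum//; last 2 first.
  - by move=> y; rewrite fE; apply/measurable_EFinP; exact: measurable_funM.
  - by move=> y x _; rewrite /f lee_fin mulr_ge0.
  rewrite -sumEFin !big_seq; apply: eq_bigr => y ys'.
  rewrite fE; under eq_integral do rewrite EFinM.
  rewrite ge0_integralZl//; last 2 first.
  - exact/measurable_EFinP.
  - by rewrite lee_fin.
  rewrite integral_indic// setIT ys' EFinM fineK//.
  by rewrite ge0_fin_numE//; apply: hfin; exact: sn0.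
rewrite [X in fine X]areaE /= mulr_sumr [RHS]big_tnth; apply: eq_bigr => i _.
by rewrite -/(y_ i); ring.
Qed.

End laplace_functional.

Section laplace_functional_limit.
Local Open Scope ereal_scope.
Context {d} {T : measurableType d} {R : realType} (P : probability T R).
Variables (lambda : R) (E : nat -> {RV P >-> plane R}).
Hypothesis lambda_ge0 : (0 <= lambda)%R.
Hypothesis E_poisson : homogeneous_poisson_process lambda E.

Lemma cvg_integral_monotone {d'} {S : measurableType d'}
    (mu : {measure set S -> \bar R}) (u : nat -> S -> R) (v : S -> R) :
  (forall n, measurable_fun setT (u n)) -> (forall n x, (0 <= u n x)%R) ->
  (forall x, {homo u ^~ x : m n / (m <= n)%N >-> (m <= n)%R}) ->
  (forall x, u n x @[n --> \oo] --> v x) ->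
  \int[mu]_x (u n x)%:E @[n --> \oo] --> \int[mu]_x (v x)%:E.
Proof.
move=> mu0 u0 und uv.
rewrite (_ : \int[mu]_x (v x)%:E = \int[mu]_x limn ((fun n x => (u n x)%:E) ^~ x)).
  apply: cvg_monotone_convergence => //.
  - by move=> n; exact/measurable_EFinP.
  - by move=> n x _; rewrite lee_fin.
  - by move=> x _ m n mn; rewrite lee_fin und.
apply: eq_integral => x _; apply/esym/cvg_lim => //.
by apply: cvg_EFin; [exact: nearW|exact: uv].
Qed.

(** The series is an integral for the counting measure, so this is monotone convergence again. *)
Lemma cvg_nneseries_monotone (u : nat -> nat -> R) (v : nat -> R) :
  (forall n j, (0 <= u n j)%R) ->
  (forall j, {homo u ^~ j : m n / (m <= n)%N >-> (m <= n)%R}) ->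
  (forall j, u n j @[n --> \oo] --> v j) ->
  \sum_(0 <= j <oo) (u n j)%:E @[n --> \oo] --> \sum_(0 <= j <oo) (v j)%:E.
Proof.
move=> u0 und uv.
have v0 j : (0 <= v j)%R.
  by apply: (cvgr_to_ge (uv j)); exact: nearW.
rewrite -(@ge0_integral_count _ (fun j => (v j)%:E)); last by move=> j; rewrite lee_fin.
rewrite (_ : (fun n => _) = fun n => \int[counting]_j (u n j)%:E); last first.
  by apply/funext => n; rewrite ge0_integral_count// => j; rewrite lee_fin.
exact: cvg_integral_monotone.
Qed.

Import HBNNSimple.

(** Increasing simple functions approximate [phi]. The expectations converge by domination, the
    kernel being at most 1, and the area integrals by monotonicity. Finiteness is asked of
    [1 - expR (- phi x)], which in the application is the interception probability itself. *)
Lemma poisson_laplace_functional (phi : plane R -> R) :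
  measurable_fun setT phi -> (forall x, (0 <= phi x)%R) ->
  \int[area]_x (1 - expR (- phi x))%:E < +oo ->
  \int[P]_w (expNe (\sum_(0 <= j <oo) (phi (E j w))%:E))%:E =
  (expR (- (lambda * fine (\int[area]_x (1 - expR (- phi x))%:E))))%:E.
Proof.
move=> mphi phi0 phi_fin.
have mphiE : measurable_fun setT (EFin \o phi) by exact/measurable_EFinP.
pose h := nnsfun_approx measurableT mphiE.
have hphi x : h n x @[n --> \oo] --> phi x.
  have /fine_cvgP[_] := cvg_nnsfun_approx measurableT mphiE (fun x _ => phi0 x) (x := x) I.
  exact.
have hnd x : {homo (fun n => h n x) : m n / (m <= n)%N >-> (m <= n)%R}.
  by move=> m n mn; exact/lefP/nd_nnsfun_approx.
have hle n x : (h n x <= phi x)%R.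
  rewrite -(cvg_lim _ (hphi x))//; apply: nondecreasing_cvgn_le => //.
  by apply: cvgP; exact: hphi.
pose g (f : plane R -> R) x := (1 - expR (- f x))%R.
have g0 (f : plane R -> R) x : (0 <= f x)%R -> (0 <= g f x)%R.
  by move=> fx; rewrite subr_ge0 -expR0 ler_expR lerNl oppr0.
have mg (f : plane R -> R) : measurable_fun setT f -> measurable_fun setT (g f).
  move=> mf; apply: measurable_funB => //.
  by apply: measurableT_comp => //; exact: measurableT_comp.
(* Markov's inequality: since [h n] is at most [phi], its level set at [y > 0] lies where
   [1 - expR (- phi)] is at least [1 - expR (- y)]. *)
have hfin n y : y != 0%R -> area (h n @^-1` [set y]) < +oo.
  move=> y0; have [[x hx]|nx] := pselect (exists x, h n x = y); last first.
    rewrite (_ : _ @^-1` _ = set0) ?measure0//.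
    by apply/seteqP; split => // x /= hx; apply: nx; exists x.
  have {}y0 : (0 < y)%R by rewrite lt_neqAle eq_sym y0 -hx fun_ge0.
  have c0 : (0 < 1 - expR (- y))%R by rewrite subr_gt0 -expR0 ltr_expR ltrNl oppr0.
  have mgphi : measurable_fun setT (EFin \o g phi) by apply/measurable_EFinP; exact: mg.
  have := @le_integral_abse _ _ _ area setT measurableT _ _ mgphi c0.
  under eq_integral do rewrite /= ger0_norm ?g0//.
  move=> le_int.
  rewrite (@le_lt_trans _ _ (area [set x | (1 - expR (- y) <= g phi x)%R]))//.
    rewrite le_measure ?inE//.
    - by apply: measurable_set_ler => //; exact: mg.
    - by move=> z /= <-; rewrite lerD2l lerN2 ler_expR lerN2 hle.
  rewrite -(@lte_pmul2l _ (1 - expR (- y))%:E)//.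
  rewrite mulry gtr0_sg// mul1e (le_lt_trans _ phi_fin)//.
  apply: le_trans le_int; rewrite lee_pmul2l// le_measure ?inE//.
  - by apply: measurable_set_ler => //; exact: mg.
  - rewrite setTI; apply: measurable_set_ler => //.
    apply: measurableT_comp => //; exact: mg.
  - by move=> z /= gz; split => //=; rewrite lee_fin ger0_norm ?g0.
have LHS : \int[P]_w (expNe (\sum_(0 <= j <oo) (h n (E j w))%:E))%:E @[n --> \oo] -->
    \int[P]_w (expNe (\sum_(0 <= j <oo) (phi (E j w))%:E))%:E.
  apply: (@dominated_cvg _ _ _ P setT measurableT _ _ (cst 1)) => //.
  - move=> n; apply/measurable_EFinP; apply: (measurableT_comp measurable_expNe).
    apply: ge0_emeasurable_sum => [j w _ _|j _]; first by rewrite lee_fin.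
    by apply/measurable_EFinP; exact: measurableT_comp.
  - move=> w _; apply: cvg_EFin; first exact: nearW.
    apply: cvg_expNe; first by move=> n; apply: nneseries_ge0 => j _ _; rewrite lee_fin.
    exact: cvg_nneseries_monotone.
  - exact: finite_measure_integrable_cst.
  - move=> n w _; rewrite /= ger0_norm ?expNe_ge0// lee_fin expNe_le1//.
    by apply: nneseries_ge0 => j _ _; rewrite lee_fin.
have RHS : \int[area]_x (g (h n) x)%:E @[n --> \oo] --> \int[area]_x (g phi x)%:E.
  apply: cvg_integral_monotone => //.
  - by move=> n; exact: mg.
  - by move=> n x; exact: g0.
  - by move=> x m n mn; rewrite lerD2l lerN2 ler_expR lerN2 hnd.
  - move=> x; apply: cvgB; first exact: cvg_cst.
    apply: (@cvg_comp _ _ _ (fun n => - h n x)%R expR _ (nbhs (- phi x)%R)).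
      exact: cvgN.
    exact: continuous_expR.
have RHS' : (expR (- (lambda * fine (\int[area]_x (g (h n) x)%:E))))%:E @[n --> \oo] -->
    (expR (- (lambda * fine (\int[area]_x (g phi x)%:E))))%:E.
  apply: cvg_EFin; first exact: nearW.
  apply: (@cvg_comp _ _ _
    (fun n => - (lambda * fine (\int[area]_x (g (h n) x)%:E)))%R expR _
    (nbhs (- (lambda * fine (\int[area]_x (g phi x)%:E)))%R)).
    apply: cvgN; apply: cvgMr; apply: fine_cvg; rewrite fineK//.
    rewrite ge0_fin_numE//; apply: integral_ge0 => x _.
    by rewrite lee_fin g0.
  exact: continuous_expR.
move: LHS; under eq_fun do rewrite (poisson_laplace_nnsfun lambda_ge0 E_poisson (hfin _)).
by move=> LHS; exact: cvg_unique LHS RHS'.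
Qed.

End laplace_functional_limit.

(** * Integrals and null sets in the plane *)

Section measurable_arithmetic.
Context {R : realType}.

Lemma measurable_inv : measurable_fun [set: R] (@GRing.inv R).
Proof.
(* Inversion is discontinuous at 0, where its value is 0; the factor [x] gives this value whatever
   the power is there. *)
rewrite (_ : @GRing.inv R = (fun x => x * (x ^+ 2) `^ (-1))).
  apply: measurable_funM => //; apply: (measurableT_comp (measurable_powR _)) => //.
apply/funext => x; rewrite powR_inv1 ?sqr_ge0//.
have [->|x0] := eqVneq x 0; first by rewrite invr0 mul0r.
by field.
Qed.

Lemma measurable_funV {d} {T : measurableType d} (D : set T) (f : T -> R) :
  measurable_fun D f -> measurable_fun D (fun x => (f x)^-1).
Proof. by move=> mf; apply: measurableT_comp => //; exact: measurable_inv. Qed.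

Lemma measurable_inve : measurable_fun setT (@inve R).
Proof.
(* At [+oo] the last branch is right as well: [fine] gives 0 there, and [0^-1 = 0]. *)
rewrite (_ : @inve R = (fun x => if x == 0%E then +oo%E else
    if x == -oo%E then -oo%E else ((fine x)^-1)%:E)).
  apply: measurable_fun_ifT => //; first exact: measurable_fun_eqe.
  apply: measurable_fun_ifT => //; first exact: measurable_fun_eqe.
  apply/measurable_EFinP; apply: measurable_funV; exact: fine_measurable.
apply/funext => -[x| |]//=; rewrite ?invr0//.
Qed.

Lemma measurable_plane_dist {d} {T : measurableType d} (f g : T -> plane R) :
  measurable_fun setT f -> measurable_fun setT g ->
  measurable_fun setT (fun w => plane_dist (f w) (g w)).
Proof.
move=> mf mg; apply: measurableT_comp.
  by apply: continuous_measurable_fun; exact: sqrt_continuous.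
apply: measurable_funD; apply: measurable_funX; apply: measurable_funB.
- exact: (measurableT_comp measurable_fst mf).
- exact: (measurableT_comp measurable_fst mg).
- exact: (measurableT_comp measurable_snd mf).
- exact: (measurableT_comp measurable_snd mg).
Qed.

End measurable_arithmetic.

Section null_sets.
Local Open Scope ereal_scope.
Context {R : realType}.
Notation mu := (@lebesgue_measure R).

Lemma lebesgue_measure_quadratic_roots (a b c : R) : (a != 0)%R \/ (b != 0)%R ->
  mu [set y | a * y ^+ 2 + b * y + c = 0]%R = 0.
Proof.
move=> ab.
have [[y0 y0E]|ny] := pselect (exists y, a * y ^+ 2 + b * y + c = 0)%R; last first.
  rewrite (_ : [set y | _] = set0) ?measure0//.
  by apply/seteqP; split => // y yE; apply: ny; exists y.
apply: countable_lebesgue_measure0; apply: finite_set_countable.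
(* The second candidate is the other root by Vieta. When [a = 0] it is a harmless extra point, as
   [b != 0] leaves [y0] as the only root. *)
apply: (@sub_finite_set _ _ [set y0; (- b / a - y0)%R]) => // y /= yE.
have : ((y - y0) * (a * (y + y0) + b) =
    (a * y ^+ 2 + b * y + c) - (a * y0 ^+ 2 + b * y0 + c))%R by ring.
rewrite yE y0E subrr => /eqP; rewrite mulf_eq0.
move=> /orP[/eqP/subr0_eq ->|/eqP H]; first by left.
right; have [a0|a0] := eqVneq a 0%R.
  by move: H ab; rewrite a0 mul0r add0r eqxx => -> []; rewrite ?eqxx.
apply: (mulfI a0); have -> : (a * (- b / a - y0) = - b - a * y0)%R by field.
by apply/eqP; rewrite -subr_eq0 -H; apply/eqP; ring.
Qed.

(** Tonelli over vertical lines. One exceptional abscissa is allowed because the null set may itself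
    be a vertical line. *)
Lemma area_null (Z : set (plane R)) : measurable Z ->
  (exists x0, forall x, x != x0 -> mu [set y | Z (x, y)] = 0) -> area Z = 0.
Proof.
move=> mZ [x0 Zx0]; rewrite /area /= /product_measure1.
rewrite (ae_eq_integral (cst 0))//; first by rewrite integral0.
  exact: measurable_fun_xsection.
exists [set x0]; split; [exact: measurable_set1|exact: lebesgue_measure_set1|].
move=> x /= Hx; apply: contrapT => /eqP xx0; apply: Hx => _ /=.
rewrite -[RHS](Zx0 x xx0); congr (mu _).
by apply/seteqP; split => y; rewrite /xsection/= inE.
Qed.

(* The locus is a circle or, when c = 1, a line. *)
Lemma area_apollonius (A B : R * R) (c : R) : A != B ->
  area [set x : plane R | plane_dist A x ^+ 2 = c * plane_dist B x ^+ 2]%R = 0.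
Proof.
move=> AB.
have dE (C : R * R) (x : plane R) :
    (plane_dist C x ^+ 2 = (C.1 - x.1) ^+ 2 + (C.2 - x.2) ^+ 2)%R.
  by rewrite sqr_sqrtr// addr_ge0 ?sqr_ge0.
apply: area_null.
  rewrite (_ : [set x | _] = [set x : plane R |
      (plane_dist A x ^+ 2 <= c * plane_dist B x ^+ 2)%R] `&`
      [set x : plane R | (c * plane_dist B x ^+ 2 <= plane_dist A x ^+ 2)%R]); last first.
    apply/seteqP; split => [x /= ->|x /= [h1 h2]]; first by split.
    by apply/eqP; rewrite eq_le h1.
  have mA (C : R * R) : measurable_fun setT (fun x : plane R => plane_dist C x ^+ 2)%R.
    apply: measurable_funX.
    exact: (@measurable_plane_dist _ _ _ (cst (C : plane R)) id).
  by apply: measurableI; apply: measurable_set_ler => //; apply: measurable_funM.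
(* The equation in [y] degenerates only when [c = 1] and the two points have the same ordinate; the
   locus is then their perpendicular bisector, the vertical line at this abscissa. *)
exists ((A.1 + B.1) / 2)%R => x xAB.
have [cab|] := pselect ((1 - c != 0)%R \/ (- (A.2 - c * B.2) *+ 2 != 0)%R).
  rewrite -(lebesgue_measure_quadratic_roots ((A.1 - x) ^+ 2 + A.2 ^+ 2 -
     c * ((B.1 - x) ^+ 2 + B.2 ^+ 2)) cab).
  congr (mu _); apply/seteqP; split => y /=; rewrite !dE/= => H.
    transitivity ((A.1 - x) ^+ 2 + (A.2 - y) ^+ 2 -
      c * ((B.1 - x) ^+ 2 + (B.2 - y) ^+ 2))%R; [ring|by rewrite H subrr].
  by apply/eqP; rewrite -subr_eq0; apply/eqP; rewrite -[RHS]H; ring.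
move=> /not_orP[/negP]; rewrite negbK subr_eq0 => /eqP <- /negP.
rewrite mul1r negbK mulrn_eq0/= oppr_eq0 subr_eq0 => /eqP AB2.
have AB1 : (A.1 != B.1)%R.
  apply: contra AB => /eqP AB1; apply/eqP.
  by rewrite [A]surjective_pairing [B]surjective_pairing AB1 AB2.
rewrite (_ : [set y | _] = set0) ?measure0//; apply/seteqP; split => // y /=.
rewrite !dE/= mul1r AB2 => /addIr/eqP; rewrite eqf_sqr => /orP[/eqP/addIr AB1'|/eqP H].
  by rewrite AB1' eqxx in AB1.
by move: xAB => /eqP; apply; lra.
Qed.

End null_sets.

(** * Finiteness of the integrals over the plane *)

Section gaussian_bound.
Local Open Scope ereal_scope.
Context {R : realType}.
Notation mu := (@lebesgue_measure R).

Lemma gaussian_integral_fin (s a : R) : (0 < s)%R ->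
  \int[mu]_x (expR (- (s * (a - x) ^+ 2)))%:E < +oo.
Proof.
(* The standard deviation for which the normal density centred at [a] is proportional to the
   integrand. *)
move=> s0; pose sg := Num.sqrt (s *+ 2)^-1.
have sg0 : (sg != 0)%R by rewrite gt_eqF// sqrtr_gt0 invr_gt0 mulrn_wgt0.
have sg2 : (sg ^+ 2 = (s *+ 2)^-1)%R by rewrite sqr_sqrtr// invr_ge0 mulrn_wge0// ltW.
have pk0 := normal_peak_gt0 sg0.
rewrite (_ : (fun x => _) =
  (fun x => ((normal_peak sg)^-1)%:E * (normal_pdf a sg x)%:E)); last first.
  apply/funext => x; rewrite normal_pdfE//= -EFinM mulKf ?gt_eqF//.
  rewrite /normal_fun sg2; congr (expR _)%:E.
  by rewrite -(sqrrN (a - x)) opprB; field; rewrite gt_eqF//= mulrn_wgt0.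
rewrite ge0_integralZl//; last 3 first.
- by apply/measurable_EFinP; exact: measurable_normal_pdf.
- by move=> x _; rewrite lee_fin normal_pdf_ge0.
- by rewrite lee_fin invr_ge0 ltW.
by rewrite integral_normal_pdf mule1 ltry.
Qed.

(** The term [- 1] takes care of distances below 1, where the power can be smaller than the square.
    In the Gaussian bound it costs only the constant factor [expR s]. *)
Lemma sqr_le_powR (alpha r : R) : (2 <= alpha)%R -> (0 <= r)%R ->
  (r ^+ 2 - 1 <= r `^ alpha)%R.
Proof.
move=> a2 r0; have [r1|r1] := leP 1%R r.
  rewrite (@le_trans _ _ (r ^+ 2)%R)//; first by lra.
  by rewrite -powR_mulrn// ler_powR.
rewrite (@le_trans _ _ 0%R) ?powR_ge0//; rewrite subr_le0.
by rewrite expr_le1// ltW.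
Qed.

Lemma integral_expR_dist_fin (alpha s : R) (A : R * R) : (2 <= alpha)%R -> (0 < s)%R ->
  \int[area]_x (expR (- (s * plane_dist A x `^ alpha)))%:E < +oo.
Proof.
move=> a2 s0.
pose G (a x : R) := expR (- (s * (a - x) ^+ 2)).
have mG a : measurable_fun setT (G a).
  apply: measurableT_comp => //; apply: measurableT_comp => //.
  apply: measurable_funM => //; apply: measurable_funX.
  exact: measurable_funB.
have mGG : measurable_fun setT (fun x : plane R => (expR s * (G A.1 x.1 * G A.2 x.2))%:E).
  apply/measurable_EFinP; apply: measurable_funM => //; apply: measurable_funM.
    exact: measurableT_comp (mG _) measurable_fst.
  exact: measurableT_comp (mG _) measurable_snd.
have mpd : measurable_fun setT (fun x : plane R => (plane_dist A x `^ alpha)%R).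
  apply: (measurableT_comp (measurable_powR _)).
  exact: (@measurable_plane_dist _ _ _ (cst (A : plane R)) id).
apply: (@le_lt_trans _ _ (\int[area]_x (expR s * (G A.1 x.1 * G A.2 x.2))%:E)).
  apply: ge0_le_integral => //.
  - apply/measurable_EFinP; apply: measurableT_comp => //.
    by apply: measurableT_comp => //; exact: measurable_funM.
  - move=> x _; rewrite lee_fin /G -!expRD ler_expR.
    have : (plane_dist A x ^+ 2 - 1 <= plane_dist A x `^ alpha)%R.
      by rewrite sqr_le_powR// sqrtr_ge0.
    rewrite sqr_sqrtr ?addr_ge0 ?sqr_ge0// -(ler_pM2l s0).
    by rewrite !mulrBr !mulrDr mulr1 => h; lra.
rewrite fubini_tonelli1//; last first.
  by move=> x; rewrite lee_fin !mulr_ge0 ?expR_ge0.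
rewrite /fubini_F/=.
have inner x : \int[mu]_y (expR s * (G A.1 x * G A.2 y))%:E =
    (G A.1 x)%:E * ((expR s)%:E * \int[mu]_y (G A.2 y)%:E).
  under eq_integral do rewrite mulrCA EFinM.
  rewrite ge0_integralZl//; last 3 first.
  - by apply/measurable_EFinP; apply: measurable_funM => //; exact: mG.
  - by move=> y _; rewrite lee_fin mulr_ge0 ?expR_ge0.
  - by rewrite lee_fin expR_ge0.
  congr (_ * _); under eq_integral do rewrite EFinM.
  rewrite ge0_integralZl//.
  - by apply/measurable_EFinP; exact: mG.
  - by move=> y _; rewrite lee_fin expR_ge0.
under eq_integral do rewrite inner.
have I0 a : 0 <= \int[mu]_y (G a y)%:E.
  by apply: integral_ge0 => y _; rewrite lee_fin expR_ge0.
rewrite ge0_integralZr//; last 3 first.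
- by apply/measurable_EFinP; exact: mG.
- by move=> y _; rewrite lee_fin expR_ge0.
- by rewrite mule_ge0// lee_fin expR_ge0.
have If a : \int[mu]_y (G a y)%:E \is a fin_num.
  by rewrite ge0_fin_numE//; exact: gaussian_integral_fin.
by rewrite ltey_eq fin_numM ?fin_numM ?If.
Qed.

End gaussian_bound.

(** * Eavesdroppers at fixed positions *)

Section path_loss.
Context {R : realType} {N : nat}.
Variables (A : 'I_N.+1 -> R * R) (p : 'I_N -> R) (alpha : R).
Hypothesis alpha_gt2 : 2 < alpha.
Hypothesis A_inj : injective A.
Hypothesis p_gt0 : forall i, 0 < p i.

Notation a := (scaled_loss A p alpha).

Let alpha_gt0 : 0 < alpha. Proof. by apply: lt_trans alpha_gt2. Qed.

Lemma tx_inj : injective (tx A).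
Proof. by move=> i j /A_inj/(congr1 val)/= /val_inj. Qed.

Lemma scaled_loss_ge0 k x : 0 <= a k x.
Proof. by rewrite mulr_ge0 ?powR_ge0// invr_ge0 ltW. Qed.

Lemma measurable_plane_dist_from (C : R * R) :
  measurable_fun setT (fun x : plane R => plane_dist C x).
Proof. exact: (@measurable_plane_dist _ _ _ (cst (C : plane R)) id). Qed.

Lemma measurable_scaled_loss k : measurable_fun setT (fun x : plane R => a k x).
Proof.
apply: measurable_funM => //; apply: (measurableT_comp (measurable_powR _)).
exact: measurable_plane_dist_from.
Qed.

Lemma measurable_scp_integrand {d} {S : measurableType d} (t : S -> R)
    (x : S -> plane R) : measurable_fun setT t -> measurable_fun setT x ->
  measurable_fun setT (fun s => scp_integrand A p alpha (t s) (x s)).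
Proof.
move=> mt mx.
have mdist k : measurable_fun setT (fun s => plane_dist (tx A k) (x s) `^ alpha).
  apply: (measurableT_comp (measurable_powR _)).
  exact: (measurableT_comp (measurable_plane_dist_from _)).
have mloss k : measurable_fun setT (fun s => a k (x s)).
  exact: (measurableT_comp (measurable_scaled_loss k)).
apply: measurable_sum => k; apply: measurable_funM.
  under eq_fun do rewrite big_mkcond/=.
  apply: measurable_prod => m _; case: (m != k) => //; apply: measurable_funM => //.
  by apply: measurable_funV; exact: measurable_funB.
apply: measurableT_comp => //; apply: measurableT_comp => //.
by apply: measurable_funM => //; exact: measurable_funM.
Qed.

(** The positions at which the partial fractions break down: a transmitter, where a rate vanishes,
    or a point where two rates coincide. Each coincidence is an Apollonius locus of two
    transmitters. *)
Definition degenerate_points : set (plane R) :=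
  [set x | ~ ((forall k, 0 < a k x) /\ injective (a ^~ x))].

Let apollonius_set m k := [set x : plane R | a m x = a k x].
Let vertex_set k := [set x : plane R | a k x = 0].

Let measurable_eq_set (f h : plane R -> R) :
  measurable_fun setT f -> measurable_fun setT h ->
  measurable [set x | f x = h x].
Proof.
move=> mf mh; rewrite (_ : [set x | _] = [set x | f x <= h x] `&` [set x | h x <= f x]).
  by apply: measurableI; exact: measurable_set_ler.
apply/seteqP; split => [x /= ->|x /= [fh hf]]; first by split.
by apply/eqP; rewrite eq_le fh.
Qed.

Let degenerate_pointsE : degenerate_points =
  \big[setU/set0]_k (vertex_set k `|`
    \big[setU/set0]_(m | m != k) apollonius_set m k).
Proof.
rewrite -bigcup_seq; apply/seteqP; split => x.
  move=> /not_andP[/existsNP[k /negP]|].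
    rewrite lt_neqAle scaled_loss_ge0 andbT negbK => /eqP xk.
    by exists k; [rewrite /= mem_index_enum|left].
  move=> /existsNP[m /existsNP[k /not_implyP[xmk /eqP mk]]].
  exists k; first by rewrite /= mem_index_enum.
  by right; rewrite -bigcup_seq_cond; exists m; rewrite //= mem_index_enum.
move=> [k _ [xk [a0 _]|]]; first by have := a0 k; rewrite xk ltxx.
by rewrite -bigcup_seq_cond => -[m /= /andP[_ mk] xmk [_ /(_ _ _ xmk)/eqP]];
  rewrite (negPf mk).
Qed.

Lemma measurable_degenerate_points : measurable degenerate_points.
Proof.
have ma := measurable_scaled_loss.
rewrite degenerate_pointsE; apply: bigsetU_measurable => k _.
apply: measurableU; first exact: measurable_eq_set.
by apply: bigsetU_measurable => m _; exact: measurable_eq_set.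
Qed.

Let vertex_set_null k : area (vertex_set k) = 0%E.
Proof.
have ma := measurable_scaled_loss.
(* Any second focus distinct from the transmitter will do: with ratio 0 the Apollonius locus is the
   transmitter alone. *)
pose B : R * R := ((tx A k).1 + 1, (tx A k).2).
have AB : tx A k != B.
  apply/eqP => /(congr1 fst)/= /eqP.
  by rewrite -subr_eq0 opprD addNKr oppr_eq0 oner_eq0.
have md C := measurable_funX 2 (measurable_plane_dist_from C).
apply: (subset_measure0 _ _ _ (area_apollonius 0 AB)).
- exact: measurable_eq_set.
- by apply: measurable_eq_set => //; exact: measurable_funM.
- move=> x /=; rewrite /vertex_set/= /scaled_loss mul0r => /eqP.
  rewrite mulf_eq0 invr_eq0 gt_eqF//= powR_eq0 => /andP[/eqP -> _].
  by rewrite expr0n.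
Qed.

Let apollonius_set_null m k : m != k -> area (apollonius_set m k) = 0%E.
Proof.
move=> mk; have ma := measurable_scaled_loss.
have AB : tx A m != tx A k by rewrite (inj_eq tx_inj).
(* Raising the equality of the losses to the power [2 / alpha] makes it an equation between squared
   distances. *)
pose c := (p m / p k) `^ (2 / alpha).
have dE C (x : R * R) : (plane_dist C x `^ alpha) `^ (2 / alpha) = plane_dist C x ^+ 2.
  by rewrite -powRrM mulrCA divff ?gt_eqF// mulr1 powR_mulrn// sqrtr_ge0.
have md C := measurable_funX 2 (measurable_plane_dist_from C).
apply: (subset_measure0 _ _ _ (area_apollonius c AB)).
- exact: measurable_eq_set.
- by apply: measurable_eq_set => //; exact: measurable_funM.
- move=> x /=; rewrite /apollonius_set/= /scaled_loss => xmk.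
  rewrite -!dE /c -powRM ?powR_ge0 ?divr_ge0 ?ltW//; congr (_ `^ _).
  by rewrite -mulrA -xmk mulrA divff ?mul1r// gt_eqF.
Qed.

Lemma area_degenerate_points : area degenerate_points = 0%E.
Proof.
have ma := measurable_scaled_loss.
apply: measure_negligible; first exact: measurable_degenerate_points.
rewrite degenerate_pointsE.
apply: (big_ind (fun S => area.-negligible S)).
- exact: negligible_set0.
- by move=> ? ?; exact: negligibleU.
- move=> k _; apply: negligibleU.
    by apply/negligibleP; [exact: measurable_eq_set|exact: vertex_set_null].
  apply: (big_ind (fun S => area.-negligible S)).
  + exact: negligible_set0.
  + by move=> ? ?; exact: negligibleU.
  + move=> m mk; apply/negligibleP; first exact: measurable_eq_set.
    exact: apollonius_set_null.
Qed.

End path_loss.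

Section eavesdropper.
Local Open Scope ereal_scope.
Context {R : realType} {N : nat} {d} {T : measurableType d} (P : probability T R).
Variables (A : 'I_N.+1 -> R * R) (p : 'I_N -> R) (alpha : R) (X : 'I_N -> T -> R).
Hypothesis alpha_gt2 : (2 < alpha)%R.
Hypothesis A_inj : injective A.
Hypothesis p_gt0 : forall i, (0 < p i)%R.
Hypothesis N_gt0 : (0 < N)%N.
Hypothesis mX : forall i, measurable_fun setT (X i).
Hypothesis XI : mutually_independent P X.
Hypothesis Xexp : forall i (B : set R), measurable B ->
  P (X i @^-1` B) = exponential_prob 1 B.

Notation a := (scaled_loss A p alpha).
Notation Z := (degenerate_points A p alpha).

Definition received_snr (x : plane R) (w : T) : R :=
  (\sum_(k < N) p k * X k w / plane_dist (tx A k) x `^ alpha)%R.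

Lemma received_snrE x w : received_snr x w = (\sum_k X k w / a k x)%R.
Proof.
apply: eq_bigr => k _; rewrite /scaled_loss invfM invrK.
by rewrite [RHS]mulrCA mulrA.
Qed.

Lemma measurable_received_snr x : measurable_fun setT (received_snr x).
Proof.
apply: measurable_sum => k; apply: measurable_funM => //.
exact: measurable_funM.
Qed.

Lemma received_snr_tail (t : R) x : ~ Z x -> (0 <= t)%R ->
  P [set w | (t < received_snr x w)%R] = (scp_integrand A p alpha t x)%:E.
Proof.
move=> /contrapT[a0 ai] t0.
rewrite (_ : [set w | _] = [set w | (t < \sum_k X k w / a k x)%R]); last first.
  by apply/seteqP; split => w /=; rewrite received_snrE.
rewrite (hypoexponential_tail mX XI Xexp (index_enum_uniq _)
  (fun k _ => a0 k) (fun k m _ _ => @ai k m) t0).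
rewrite /scp_integrand; congr (_%:E); apply: eq_bigr => k _.
by rewrite [X in (_ * expR (- (X * _)))%R = _]/scaled_loss [X in (X * t)%R]mulrC.
Qed.

Lemma scp_integrand_ge0 (t : R) x : ~ Z x -> (0 <= t)%R ->
  (0 <= scp_integrand A p alpha t x)%R.
Proof. by move=> Zx t0; rewrite -lee_fin -received_snr_tail. Qed.

(** Pigeonhole threshold: if the sum of [N] terms exceeds [t], one of them exceeds [t / N]. *)
Let share (t : R) := (t / N%:R)%R.

Let below_share (t : R) x w : (0 <= t)%R ->
  (forall k, X k w / a k x <= share t)%R -> (received_snr x w <= t)%R.
Proof.
move=> t0 Xw; rewrite received_snrE (@le_trans _ _ (\sum_(k < N) share t)%R)//.
  by apply: ler_sum => k _; exact: Xw.
by rewrite sumr_const card_ord -mulr_natr divfK// pnatr_eq0 -lt0n.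
Qed.

Let share_gt0 (t : R) : (0 < t)%R -> (0 < share t)%R.
Proof. by move=> t0; rewrite divr_gt0// ltr0n. Qed.

(** A union bound over the term that exceeds its share. Each summand on the right is integrable over
    the plane, which the signed partial fractions do not show. *)
Lemma scp_integrand_le (t : R) x : ~ Z x -> (0 < t)%R ->
  (scp_integrand A p alpha t x <= \sum_k expR (- (a k x * (t / N%:R))))%R.
Proof.
move=> Zx t0; have /contrapT[a0 ai] := Zx.
rewrite -lee_fin -received_snr_tail ?(ltW t0)//.
pose F k := [set w | (a k x * share t < X k w)%R].
have mF k : measurable (F k) by exact: measurable_set_ltr.
apply: (@le_trans _ _ (P (\big[setU/set0]_k F k))).
  rewrite le_measure ?inE//.
  - by apply: measurable_set_ltr => //; exact: measurable_received_snr.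
  - exact: bigsetU_measurable.
  - move=> w /= tw; apply: contrapT; rewrite -bigcup_seq => nF.
    move: tw; apply/negP; rewrite -leNgt; apply: below_share; first exact: ltW.
    move=> k; rewrite leNgt; apply/negP => kX; apply: nF; exists k.
      by rewrite /= mem_index_enum.
    by rewrite /F/= mulrC -ltr_pdivlMr.
rewrite -sumEFin.
elim: (index_enum _) => [|k s IH]; first by rewrite !big_nil measure0.
rewrite !big_cons (le_trans (measureU2 _ _ _))//; first exact: bigsetU_measurable.
rewrite leeD// [X in X <= _](exponential_tail (Xexp k))// mulr_ge0// ?ltW ?a0//.
exact: share_gt0.
Qed.

(** By independence, all terms stay below their share with positive probability, and then the sum
    does not exceed [t]. Positivity of [t] is essential: at [t = 0] the integrand is 1. *)
Lemma scp_integrand_lt1 (t : R) x : ~ Z x -> (0 < t)%R ->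
  (scp_integrand A p alpha t x < 1)%R.
Proof.
move=> Zx t0; have /contrapT[a0 ai] := Zx.
pose B k := [set y : R | (y <= a k x * share t)%R].
have mB k : measurable (B k) by apply: measurable_set_ler.
have PB k : P (X k @^-1` B k) = (1 - expR (- (a k x * share t)))%:E.
  rewrite (_ : X k @^-1` B k = ~` [set w | (a k x * share t < X k w)%R]).
    rewrite probability_setC; last exact: measurable_set_ltr.
    rewrite [X in _ - X](exponential_tail (Xexp k)) ?EFinB//.
    by rewrite mulr_ge0 ?ltW// share_gt0.
  by apply/seteqP; split => w; rewrite /B/= leNgt => /negP.
have := XI (index_enum_uniq _) mB.
under eq_bigr do rewrite PB.
rewrite prodEFin => PI.
rewrite -lte_fin -received_snr_tail ?(ltW t0)//.
set S := [set w | _].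
have mS : measurable S by apply: measurable_set_ltr => //; exact: measurable_received_snr.
suff : 0 < P (~` S).
  by rewrite probability_setC// sube_gt0.
apply: (@lt_le_trans _ _ (P (\bigcap_(i in [set` index_enum 'I_N]) X i @^-1` B i))).
  rewrite PI lte_fin; apply: prodr_gt0 => k _.
  by rewrite subr_gt0 -expR0 ltr_expR oppr_lt0 mulr_gt0// share_gt0.
rewrite le_measure ?inE//.
- apply: fin_bigcap_measurable => // k _.
  by rewrite -[X in measurable X]setTI; exact: mX.
- exact: measurableC.
- move=> w Bw /=; apply/negP; rewrite -leNgt; apply: below_share; first exact: ltW.
  move=> k; rewrite ler_pdivrMr ?a0// mulrC.
  by apply: Bw; rewrite /= mem_index_enum.
Qed.

(** Setting the value 0 on the degenerate points makes the bounds [0 <= q < 1] hold at every point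
    when [t > 0], so that [escape_exponent] is then nonnegative everywhere. *)
Definition interception_prob (t : R) (x : plane R) : R :=
  if x \in Z then 0%R else scp_integrand A p alpha t x.

Definition escape_exponent (t : R) (x : plane R) : R :=
  (- ln (1 - interception_prob t x))%R.

Lemma interception_prob01 t x : (0 < t)%R -> (0 <= interception_prob t x < 1)%R.
Proof.
move=> t0; rewrite /interception_prob; case: ifPn => [_|xZ].
  by rewrite lexx ltr01.
have {}xZ : ~ Z x by move: xZ; rewrite notin_setE.
by rewrite scp_integrand_ge0// ?scp_integrand_lt1// ltW.
Qed.

Lemma measurable_interception_prob t :
  measurable_fun setT (interception_prob t).
Proof.
apply: measurable_fun_ifT => //; last exact: (measurable_scp_integrand A p alpha
    (@measurable_cst _ _ _ _ _ t) (@measurable_id _ _ setT)).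
apply: (measurable_fun_bool true); rewrite setTI.
rewrite (_ : _ @^-1` _ = Z); first exact: measurable_degenerate_points.
by apply/seteqP; split => x; rewrite /preimage/=; [move=> /set_mem|move=> /mem_set].
Qed.

Lemma expRN_escape_exponent t x : (0 < t)%R ->
  expR (- escape_exponent t x) = (1 - interception_prob t x)%R.
Proof.
move=> t0; rewrite /escape_exponent opprK lnK// posrE subr_gt0.
by case/andP: (interception_prob01 x t0).
Qed.

Lemma escape_exponent_ge0 t x : (0 < t)%R -> (0 <= escape_exponent t x)%R.
Proof.
move=> t0; case/andP: (interception_prob01 x t0) => q0 q1.
by rewrite /escape_exponent oppr_ge0 ln_le0// lerBlDr lerDl.
Qed.

Lemma measurable_escape_exponent t : measurable_fun setT (escape_exponent t).
Proof.
apply: measurableT_comp => //; apply: (measurableT_comp (@measurable_ln R)).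
by apply: measurable_funB => //; exact: measurable_interception_prob.
Qed.

Lemma integral_interception_prob_fin t : (0 < t)%R ->
  \int[area]_x (interception_prob t x)%:E < +oo.
Proof.
move=> t0.
pose f k (x : plane R) := expR (- (a k x * (t / N%:R))).
have mf k : measurable_fun setT (f k).
  apply: measurableT_comp => //; apply: measurableT_comp => //.
  by apply: measurable_funM => //; exact: measurable_scaled_loss.
apply: (@le_lt_trans _ _ (\int[area]_x \sum_k (f k x)%:E)).
  apply: ge0_le_integral => //.
  - by move=> x _; rewrite lee_fin; case/andP: (interception_prob01 x t0).
  - by apply/measurable_EFinP; exact: measurable_interception_prob.
  - by apply: emeasurable_sum => k; exact/measurable_EFinP.
  - move=> x _; rewrite sumEFin lee_fin /interception_prob; case: ifPn => xZ.
      by apply: sumr_ge0 => k _; exact: expR_ge0.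
    by apply: scp_integrand_le => //; move: xZ; rewrite notin_setE.
rewrite ge0_integral_sum//; last 2 first.
- by move=> k; exact/measurable_EFinP.
- by move=> k x _; rewrite lee_fin expR_ge0.
apply: lte_sum_pinfty => k _; rewrite /f.
under eq_integral.
  move=> x _.
  rewrite (_ : a k x * _ = (share t / p k) * plane_dist (tx A k) x `^ alpha)%R.
    over.
  by rewrite /scaled_loss mulrAC [X in (X * _)%R]mulrC.
by apply: integral_expR_dist_fin; [exact: ltW|rewrite divr_gt0// share_gt0].
Qed.

Lemma Rintegral_interception_prob t :
  (\int[area]_x interception_prob t x = \int[area]_x scp_integrand A p alpha t x)%R.
Proof.
congr fine; apply: ae_eq_integral => //.
- by apply/measurable_EFinP; exact: measurable_interception_prob.
- by apply/measurable_EFinP; exact: (measurable_scp_integrand A p alpha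
    (@measurable_cst _ _ _ _ _ t) (@measurable_id _ _ setT)).
- exists Z; split.
  + exact: measurable_degenerate_points.
  + exact: area_degenerate_points.
  + move=> x /= Hx; apply: contrapT => xZ; apply: Hx => _.
    by rewrite /interception_prob memNset.
Qed.

End eavesdropper.

Section fixed_positions.
Local Open Scope ereal_scope.
Context {R : realType} {N : nat} {d} {T : measurableType d} (P : probability T R).
Variables (A : 'I_N.+1 -> R * R) (p : 'I_N -> R) (alpha : R)
  (X : 'I_N -> nat -> T -> R).
Hypothesis N_gt0 : (0 < N)%N.
Hypothesis mX : forall i j, measurable_fun setT (X i j).
Hypothesis XI : mutually_independent P (fun c : 'I_N * nat => X c.1 c.2).
Hypothesis Xexp : forall i j (B : set R), measurable B ->
  P (X i j @^-1` B) = exponential_prob 1 B.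

Notation a := (scaled_loss A p alpha).
Notation Z := (degenerate_points A p alpha).
Notation snr j := (received_snr A p alpha (fun k => X k j)).

Variables (x : nat -> plane R) (t : R).
Hypothesis t_gt0 : (0 < t)%R.
Hypothesis Zx : forall j, ~ Z (x j).

Let safe j := [set u | (snr j (x j) u <= t)%R].
Let safe_upto J := \bigcap_(j in [set j | (j < J)%N]) safe j.

Let XIj j : mutually_independent P (fun k => X k j).
Proof.
have inj : injective (fun k : 'I_N => (k, j)) by move=> k l [].
exact: (mutually_independent_comp XI inj).
Qed.

Let measurable_safe j : measurable (safe j).
Proof.
apply: measurable_set_ler => //; apply: measurable_received_snr => k.
exact: mX.
Qed.

Let P_safe j : P (safe j) = (expR (- escape_exponent A p alpha t (x j)))%:E.
Proof.
rewrite (_ : safe j = ~` [set u | (t < snr j (x j) u)%R]); last first.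
  by apply/seteqP; split => u; rewrite /safe/= leNgt => /negP.
rewrite probability_setC; last first.
  apply: measurable_set_ltr => //; apply: measurable_received_snr => k.
  exact: mX.
(* The bound below 1 concerns a deterministic function; the gains of eavesdropper 0 only supply the
   exponential variables that its proof calls for. *)
rewrite (expRN_escape_exponent A p alpha N_gt0
  (fun k => mX k 0%N) (XIj 0) (fun k => @Xexp k 0%N))//.
rewrite [X in _ - X](received_snr_tail
  (fun k => mX k j) (XIj j) (fun k => @Xexp k j))//; last exact: ltW.
by rewrite /interception_prob memNset.
Qed.

Let index_lt J : set ('I_N * nat) := [set c | (c.2 < J)%N].
Let index_eq J : set ('I_N * nat) := [set c | c.2 = J].

Let sigma_safe (K : set ('I_N * nat)) j : (forall k, K (k, j)) ->
  sigma_over (fun c : 'I_N * nat => X c.1 c.2) K (safe j).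
Proof.
move=> Kj.
pose TK := g_sigma_algebraType (preimages_over (fun c : 'I_N * nat => X c.1 c.2) K).
suff : measurable (safe j : set TK) by [].
apply: (@measurable_set_ler _ TK) => //.
apply: (@measurable_received_snr _ _ _ TK) => k.
exact: (@measurable_sigma_over _ _ _ _ _ (fun c : 'I_N * nat => X c.1 c.2) K (k, j) (Kj k)).
Qed.

Let sigma_safe_upto J :
  sigma_over (fun c : 'I_N * nat => X c.1 c.2) (index_lt J) (safe_upto J).
Proof.
pose TK := g_sigma_algebraType
  (preimages_over (fun c : 'I_N * nat => X c.1 c.2) (index_lt J)).
suff : measurable (safe_upto J : set TK) by [].
apply: fin_bigcap_measurable; first exact: finite_II.
by move=> j /= jJ; apply: sigma_safe.
Qed.

Let P_safe_upto J : P (safe_upto J) =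
  (expNe (\sum_(0 <= j < J) (escape_exponent A p alpha t (x j))%:E))%:E.
Proof.
elim: J => [|J IH].
  rewrite big_geq// expNe_EFin oppr0 expR0 -(probability_setT P); congr (P _).
  by apply/seteqP; split => // u _ j.
have -> : safe_upto J.+1 = safe_upto J `&` safe J.
  apply/seteqP; split => u.
    move=> Hu; split; last by apply: Hu; rewrite /= ltnSn.
    by move=> j /= jJ; apply: Hu; rewrite /= ltnS ltnW.
  move=> [Hu uJ] j /=; rewrite ltnS leq_eqVlt => /predU1P[->//|].
  exact: Hu.
have KL : index_lt J `&` index_eq J = set0.
  apply/seteqP; split => // c [/=]; rewrite /index_lt /index_eq/= => + cJ.
  by rewrite cJ ltnn.
rewrite (independent_sigma_over _ XI KL).
- rewrite IH P_safe big_nat_recr//= sumEFin -EFinD !expNe_EFin -EFinM.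
  by rewrite opprD expRD.
- by move=> c; exact: mX.
- exact: sigma_safe_upto.
- exact: sigma_safe.
Qed.

(** Continuity from above along the finite intersections; if the series diverges, both sides are
    0. *)
Lemma all_safe_prob :
  P [set u | forall j, (snr j (x j) u <= t)%R] =
  (expNe (\sum_(0 <= j <oo) (escape_exponent A p alpha t (x j))%:E))%:E.
Proof.
have phi0 j : (0 <= escape_exponent A p alpha t (x j))%R.
  exact: (escape_exponent_ge0 A p alpha N_gt0
  (fun k => mX k 0%N) (XIj 0) (fun k => @Xexp k 0%N)).
have mU J : measurable (safe_upto J).
  by apply: fin_bigcap_measurable => //; exact: finite_II.
rewrite (_ : [set u | _] = \bigcap_J safe_upto J); last first.
  apply/seteqP; split => [u Hu J _ j _|u Hu j]; first exact: Hu.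
  by apply: (Hu j.+1) => //=.
have c1 : P (safe_upto J) @[J --> \oo] --> P (\bigcap_J safe_upto J).
  apply: nonincreasing_cvg_mu => //.
  - by rewrite ltey_eq fin_num_measure.
  - exact: bigcap_measurable.
  - move=> m n mn; apply/subsetPset => u Hu j /= jm; apply: Hu.
    exact: leq_trans jm mn.
have c2 : P (safe_upto J) @[J --> \oo] -->
    (expNe (\sum_(0 <= j <oo) (escape_exponent A p alpha t (x j))%:E))%:E.
  rewrite (_ : (fun J => _) = (fun J =>
      (expNe (\sum_(0 <= j < J) (escape_exponent A p alpha t (x j))%:E))%:E)); last first.
    by apply/funext => J; exact: P_safe_upto.
  apply: cvg_EFin; first exact: nearW.
  apply: cvg_expNe.
    by move=> J; apply: sume_ge0 => j _; rewrite lee_fin.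
  by apply: is_cvg_nneseries => j _ _; rewrite lee_fin.
exact: cvg_unique c1 c2.
Qed.

End fixed_positions.

Section poisson_null.
Local Open Scope ereal_scope.
Context {d} {T : measurableType d} {R : realType} (P : probability T R).
Variables (lambda : R) (E : nat -> {RV P >-> plane R}).
Hypothesis E_poisson : homogeneous_poisson_process lambda E.

(** The number of points in a null set is Poisson of rate 0, hence almost surely 0. *)
Lemma poisson_avoids_null (Z : set (plane R)) : measurable Z -> area Z = 0 ->
  P.-negligible [set w | exists j, Z (E j w)].
Proof.
move=> mZ Z0; have [+ _] := E_poisson => /(_ Z 0%N mZ).
rewrite [X in X < _]Z0 ltry => /(_ isT).
rewrite [X in fine X]Z0 mulr0 /poisson_prob ltxx diracE mem_set// => P0.
exists (~` [set w | point_count (fun j => E j) Z w = 0%:R%:E]); split.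
- apply: measurableC.
  have := measurable_point_count E mZ measurableT (emeasurable_set1 0%:R%:E).
  by rewrite setTI.
- rewrite probability_setC ?P0 ?subee//.
  have := measurable_point_count E mZ measurableT (emeasurable_set1 0%:R%:E).
  by rewrite setTI.
- move=> w /= [j Zj] c0.
  have : (\d_(E j w) Z <= 0%:R%:E :> \bar R).
    rewrite -c0 /point_count (@nneseriesD1 _ _ j)//.
    by rewrite leeDl// nneseries_ge0.
  by rewrite diracE mem_set// lee_fin ler10.
Qed.

End poisson_null.

(** * The minimal hop SNR *)

Section parametric_integral.
Local Open Scope ereal_scope.
Context {R : realType} {d} {S : measurableType d}.

(** The two coordinates are integrated in turn. The sign of [f] is left free because the integrand
    of the final formula may be negative at degenerate points or for negative thresholds. *)
Lemma measurable_integral_area (f : S * plane R -> \bar R) :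
  measurable_fun setT f -> measurable_fun setT (fun s => \int[area]_x f (s, x)).
Proof.
move=> mf.
have mpos (h : S * plane R -> \bar R) : measurable_fun setT h -> (forall z, 0 <= h z) ->
    measurable_fun setT (fun s => \int[area]_x h (s, x)).
  move=> mh h0; pose RR := measurableTypeR R.
  have massoc : measurable_fun setT (fun z : (S * RR) * RR => h (z.1.1, (z.1.2, z.2))).
    apply: (measurableT_comp mh); apply: measurable_fun_pair.
      exact: measurableT_comp measurable_fst measurable_fst.
    apply: measurable_fun_pair => //.
    exact: measurableT_comp measurable_snd measurable_fst.
  have mF := measurable_fun_fubini_tonelli_F (m2 := @lebesgue_measure R) _ massoc
    (fun z => h0 _).
  have F0 z : 0 <= fubini_F (@lebesgue_measure R)
      (fun z : (S * RR) * RR => h (z.1.1, (z.1.2, z.2))) z.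
    by apply: integral_ge0.
  have mG := measurable_fun_fubini_tonelli_F (m2 := @lebesgue_measure R) _ mF F0.
  apply: (eq_measurable_fun _ _ mG) => s _; apply/esym.
  rewrite /area fubini_tonelli1//.
  exact: (measurableT_comp mh (pair1_measurable s)).
rewrite (_ : (fun s => _) = (fun s =>
    \int[area]_x f^\+ (s, x) - \int[area]_x f^\- (s, x))); last first.
  apply/funext => s; rewrite [LHS]integralE.
  by congr (_ - _); apply: eq_integral => x _; rewrite unlock.
apply: emeasurable_funB; apply: mpos => //.
- exact: measurable_funepos.
- exact: measurable_funeneg.
Qed.

End parametric_integral.

Section hops.
Local Open Scope ereal_scope.
Context {R : realType} {N : nat} {d} {T : measurableType d} (P : probability T R).
Variables (A : 'I_N.+1 -> R * R) (p : 'I_N -> R) (alpha : R).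
Variables (g : 'I_N -> {RV P >-> R}).
Hypothesis A_inj : injective A.
Hypothesis p_gt0 : forall i, (0 < p i)%R.
Hypothesis g_exp : forall i (B : set R), measurable B ->
  P (g i @^-1` B) = exponential_prob 1 B.
Hypothesis N_gt0 : (0 < N)%N.

Notation snr := (hop_snr A p alpha g).
Notation m := (min_hop_snr A p alpha g N_gt0).

Let gain i := (p i / plane_dist (tx A i) (rx A i) `^ alpha)%R.

Lemma hop_distance_gt0 i : (0 < plane_dist (tx A i) (rx A i))%R.
Proof.
have AA : tx A i != rx A i.
  apply/eqP => /A_inj/(congr1 val)/=; rewrite /bump leq0n add1n => /eqP.
  by rewrite -[X in X == _]addn0 -addn1 eqn_add2l.
rewrite sqrtr_gt0 lt_neqAle addr_ge0 ?sqr_ge0// andbT eq_sym.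
rewrite paddr_eq0 ?sqr_ge0// !sqrf_eq0 !subr_eq0.
apply: contra AA => /andP[/eqP A1 /eqP A2].
by rewrite [tx A i]surjective_pairing [rx A i]surjective_pairing A1 A2.
Qed.

Let gain_gt0 i : (0 < gain i)%R.
Proof. by rewrite divr_gt0// powR_gt0// hop_distance_gt0. Qed.

Let snrE i w : snr i w = (gain i * g i w)%R.
Proof. by rewrite /hop_snr /gain mulrAC. Qed.

Let mg i : measurable_fun setT (g i : T -> R). Proof. exact: measurable_funP. Qed.

Lemma min_hop_snr_attained w : exists i, m w = snr i w.
Proof.
rewrite /min_hop_snr; apply: (big_ind (fun r => exists i, r = snr i w)).
- by exists (Ordinal N_gt0).
- by move=> r s [i ri] [j sj]; rewrite /Num.min; case: ifP => _; [exists i|exists j].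
- by move=> i _; exists i.
Qed.

(** Stated along a map [f], so as to apply also to the identity out of [T] with only the
    sigma-algebra of the hop gains. *)
Lemma measurable_min_hop_snr {d'} (T' : measurableType d') (f : T' -> T) :
  (forall i, measurable_fun setT (fun w => g i (f w))) ->
  measurable_fun setT (fun w => m (f w)).
Proof.
move=> mgf; rewrite /min_hop_snr.
have msnr i : measurable_fun setT (fun w => snr i (f w)).
  by apply: measurable_funM => //; exact: measurable_funM.
elim: (index_enum _) => [|i s IH].
  by under eq_fun do rewrite big_nil; exact: msnr.
under eq_fun do rewrite big_cons.
exact: measurable_minr.
Qed.

Let negligible_hops (B : 'I_N -> set R) : (forall i, measurable (B i)) ->
  (forall i, P (g i @^-1` B i) = 0) ->
  P.-negligible (\big[setU/set0]_i (g i @^-1` B i)).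
Proof.
move=> mB PB; apply: (big_ind (fun S => P.-negligible S)).
- exact: negligible_set0.
- by move=> ? ?; exact: negligibleU.
- move=> i _; apply/negligibleP; last exact: PB.
  by rewrite -[X in measurable X]setTI; exact: mg.
Qed.

Lemma min_hop_snr_le0_negligible : P.-negligible [set w | (m w <= 0)%R].
Proof.
pose B (i : 'I_N) := [set y : R | (y <= 0)%R].
have mB i : measurable (B i) by apply: measurable_set_ler.
apply: (@negligibleS _ _ _ _ (\big[setU/set0]_i (g i @^-1` B i))); last first.
  apply: negligible_hops => // i.
  rewrite (_ : _ @^-1` _ = ~` [set w | (0 < g i w)%R]); last first.
    by apply/seteqP; split => w; rewrite /B/= leNgt => /negP.
  rewrite probability_setC; last exact: measurable_set_ltr.
  by rewrite [X in _ - X](exponential_tail (g_exp i))// oppr0 expR0 subee.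
move=> w /=; have [i ->] := min_hop_snr_attained w.
rewrite snrE pmulr_rle0// => gi; rewrite -bigcup_seq; exists i => //.
by rewrite /= mem_index_enum.
Qed.

(** The minimum is one of the hop values, each a positive multiple of an atomless variable. The
    point [c] is extended because it will be the supremum of the eavesdropper SNRs. *)
Lemma min_hop_snr_no_atom (c : \bar R) : P [set w | (m w)%:E = c] = 0.
Proof.
have mm : measurable_fun setT (EFin \o m).
  by apply/measurable_EFinP; exact: (@measurable_min_hop_snr _ T id).
have mS : measurable [set w | (m w)%:E = c].
  by have := mm measurableT [set c] (emeasurable_set1 _); rewrite setTI.
apply: measure_negligible => //.
case: c mS => [c| |] mS; last 2 first.
- by rewrite (_ : [set w | _] = set0); [exact: negligible_set0|apply/seteqP; split].
- by rewrite (_ : [set w | _] = set0); [exact: negligible_set0|apply/seteqP; split].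
apply: (@negligibleS _ _ _ _
  (\big[setU/set0]_i (g i @^-1` [set (c / gain i)%R]))); last first.
  apply: negligible_hops => // i; rewrite g_exp//.
  by rewrite /exponential_prob integral_set1.
move=> w /= [mc]; have [i mi] := min_hop_snr_attained w.
rewrite -bigcup_seq; exists i; first by rewrite /= mem_index_enum.
by rewrite /= -mc mi snrE mulrC mulKf// gt_eqF.
Qed.

End hops.

(** * Secure connection probability *)

Section secure_connection.
Local Open Scope ereal_scope.
Context (R : realType) (d : measure_display) (T : measurableType d)
  (P : probability T R).
Variables (alpha lambda : R) (N : nat) (A : 'I_N.+1 -> R * R) (p : 'I_N -> R)
  (E : nat -> {RV P >-> plane R})
  (g : 'I_N -> {RV P >-> R}) (gE : 'I_N -> nat -> {RV P >-> R}).
Hypotheses (alpha_gt2 : (2 < alpha)%R) (lambda_gt0 : (0 < lambda)%R)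
  (N_gt0 : (0 < N)%N) (A_inj : injective A) (p_gt0 : forall i, (0 < p i)%R)
  (E_poisson : homogeneous_poisson_process lambda E)
  (g_exp : forall i (B : set R), measurable B ->
     distribution P (g i) B = exponential_prob 1 B)
  (gE_exp : forall k j (B : set R), measurable B ->
     distribution P (gE k j) B = exponential_prob 1 B)
  (gains_indep : mutually_independent P (all_gains g gE))
  (gains_E_indep : independent_families P (all_gains g gE) E).

Notation m := (min_hop_snr A p alpha g N_gt0).
Notation Z := (degenerate_points A p alpha).
Notation G := (all_gains g gE).

Let mg i : measurable_fun setT (g i : T -> R). Proof. exact: measurable_funP. Qed.
Let mgE k j : measurable_fun setT (gE k j : T -> R). Proof. exact: measurable_funP. Qed.
Let mE j : measurable_fun setT (E j : T -> plane R). Proof. exact: measurable_funP. Qed.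
Let mG c : measurable_fun setT (G c).
Proof. by case: c => [i|[k j]]; [exact: mg|exact: mgE]. Qed.

Let hop_gains : set ('I_N + 'I_N * nat) := [set c | exists i, c = inl i].
Let eve_gains : set ('I_N + 'I_N * nat) := [set c | exists kj, c = inr kj].
(** Copies of [T] that see only the hop gains, only the eavesdropper gains and only the positions; a
    function measurable on one of them depends on that block alone. *)
Let T1 := g_sigma_algebraType (preimages_over G hop_gains).
Let T2 := g_sigma_algebraType (preimages_over G eve_gains).
Let T3 := g_sigma_algebraType (preimages_over (fun j => E j : T -> plane R) setT).

Let mid1 : measurable_fun setT (id : T -> T1).
Proof. exact: measurable_id_sigma_over. Qed.
Let mid2 : measurable_fun setT (id : T -> T2).
Proof. exact: measurable_id_sigma_over. Qed.
Let mid3 : measurable_fun setT (id : T -> T3).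
Proof. exact: measurable_id_sigma_over. Qed.

(** All gains form one block at first, since independence from the positions is a hypothesis on
    their joint family; [integral_diag] then splits the block. *)
Let diag (w : T) : T1 * T2 := (w, w).

Let mdiag : measurable_fun setT diag.
Proof. exact: measurable_fun_pair. Qed.

Let TG := g_sigma_algebraType (preimages_over G setT).

Let generated_diag (B : set (T1 * T2)) : measurable B -> generated_sigma G (diag @^-1` B).
Proof.
move=> mB.
have sub K : measurable_fun setT (id : TG -> g_sigma_algebraType (preimages_over G K)).
  by move=> _ C mC; rewrite setTI; exact: sigma_over_generated mC.
have md : measurable_fun setT (diag : TG -> T1 * T2).
  by apply: measurable_fun_pair; exact: sub.
by have := md measurableT B mB; rewrite setTI.
Qed.

Let integral_diag_positions (f : (T1 * T2) * T3 -> \bar R) :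
  measurable_fun setT f -> (forall z, 0 <= f z) ->
  \int[P]_w f (diag w, w) = \int[P]_v \int[P]_w f (diag w, v).
Proof.
move=> mf f0.
rewrite -(ge0_integral_independent (X := (id : T -> T3)) (Y := diag)
  (f := fun z : T3 * (T1 * T2) => f (z.2, z.1)))//.
- move=> B C mB mC; rewrite setIC muleC.
  by apply: gains_E_indep; [exact: generated_diag|].
- apply: (measurableT_comp mf).
  exact: (measurable_fun_pair measurable_snd measurable_fst).
Qed.

Let hop_eve_disjoint : hop_gains `&` eve_gains = set0.
Proof. by apply/seteqP; split => // c [[i ->] [kj]]. Qed.

Let integral_diag (h : T1 * T2 -> \bar R) :
  measurable_fun setT h -> (forall z, 0 <= h z) ->
  \int[P]_w h (diag w) = \int[P]_w1 \int[P]_u h (w1, u).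
Proof.
move=> mh h0.
rewrite -(ge0_integral_independent (X := (id : T -> T1)) (Y := (id : T -> T2)) (f := h))//.
by move=> B C mB mC; apply: (independent_sigma_over mG gains_indep hop_eve_disjoint).
Qed.

(** With the hop gains innermost this order serves the ties, where the minimal hop SNR has to be the
    only randomness; [integral_diag] serves the safety event, where the eavesdropper gains are
    averaged first. *)
Let integral_diagC (h : T1 * T2 -> \bar R) :
  measurable_fun setT h -> (forall z, 0 <= h z) ->
  \int[P]_w h (diag w) = \int[P]_u \int[P]_w1 h (w1, u).
Proof.
move=> mh h0.
rewrite -(ge0_integral_independent (X := (id : T -> T2)) (Y := (id : T -> T1))
  (f := fun z : T2 * T1 => h (z.2, z.1)))//.
- move=> B C mB mC; rewrite setIC muleC.
  exact: (independent_sigma_over mG gains_indep hop_eve_disjoint).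
- apply: (measurableT_comp mh).
  exact: (measurable_fun_pair measurable_snd measurable_fst).
Qed.

(** Gains are read at [u] and positions at [v], so that they can be averaged separately; the model
    is the diagonal [u = v]. *)
Let snr j (u v : T) := received_snr A p alpha (fun k => gE k j) (E j v) u.

Let sup_snr (u v : T) : \bar R := ereal_sup (range (fun j => (snr j u v)%:E)).

Let m_T1 : measurable_fun setT (m : T1 -> R).
Proof.
apply: (@measurable_min_hop_snr _ _ _ _ P A p alpha g N_gt0 _ T1 id) => i.
have Ki : hop_gains (inl i) by exists i.
exact: (@measurable_sigma_over _ _ _ _ _ G hop_gains (inl i) Ki).
Qed.

Let measurable_snr j : measurable_fun setT (fun z : T2 * T3 => snr j z.1 z.2).
Proof.
apply: measurable_sum => k; apply: measurable_funM.
  apply: measurable_funM => //.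
  have Kkj : eve_gains (inr (k, j)) by exists (k, j).
  have mk := @measurable_sigma_over _ _ _ _ _ G eve_gains (inr (k, j)) Kkj.
  exact: (measurableT_comp mk measurable_fst).
apply: measurable_funV; apply: (measurableT_comp (measurable_powR _)).
apply: (measurableT_comp (measurable_plane_dist_from _)).
have mj := @measurable_sigma_over _ _ _ _ _ (fun j => E j : T -> plane R) setT j I.
exact: (measurableT_comp mj measurable_snd).
Qed.

Let m23 : measurable_fun setT (fun z : (T1 * T2) * T3 => (z.1.2, z.2) : T2 * T3).
Proof.
apply: measurable_fun_pair => //.
exact: (measurableT_comp measurable_snd measurable_fst).
Qed.

Let m_snr3 j : measurable_fun setT (fun z : (T1 * T2) * T3 => snr j z.1.2 z.2).
Proof. exact: (measurableT_comp (measurable_snr j) m23). Qed.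

Let m_min3 : measurable_fun setT (fun z : (T1 * T2) * T3 => m z.1.1).
Proof.
apply: (measurableT_comp m_T1).
exact: (measurableT_comp measurable_fst measurable_fst).
Qed.

Let m_sup3 : measurable_fun setT (fun z : (T1 * T2) * T3 => sup_snr z.1.2 z.2).
Proof.
rewrite (_ : (fun z => _) = (fun z => esups ((fun j (z : (T1 * T2) * T3) =>
  (snr j z.1.2 z.2)%:E) ^~ z) 0%N)).
  by apply: measurable_fun_esups => j; exact/measurable_EFinP.
apply/funext => z; rewrite /sup_snr /esups /=; congr ereal_sup.
by apply/seteqP; split => [_ [j _ <-]|_ [j _ <-]]; exists j.
Qed.

Let safe3 : set ((T1 * T2) * T3) := [set z | forall j, (snr j z.1.2 z.2 <= m z.1.1)%R].
Let tie3 : set ((T1 * T2) * T3) := [set z | (m z.1.1)%:E = sup_snr z.1.2 z.2].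

Let measurable_safe3 : measurable safe3.
Proof.
rewrite (_ : safe3 = \bigcap_j [set z | (snr j z.1.2 z.2 <= m z.1.1)%R]).
  by apply: bigcap_measurable => // j _; exact: measurable_set_ler.
by apply/seteqP; split => z H j; [move=> _|]; exact: H.
Qed.

Let measurable_tie3 : measurable tie3.
Proof.
have mm : measurable_fun setT (fun z : (T1 * T2) * T3 => (m z.1.1)%:E : \bar R).
  exact/measurable_EFinP.
have := measurable_fun_eqe mm m_sup3.
move=> /(_ measurableT [set true] I); rewrite setTI.
by rewrite (_ : _ @^-1` _ = tie3)//; apply/seteqP; split => z /= /eqP.
Qed.

Let pullback (S : set ((T1 * T2) * T3)) : set T := [set w | S (diag w, w)].

Let measurable_pullback S : measurable S -> measurable (pullback S).
Proof.
move=> mS; have md : measurable_fun setT (fun w : T => (diag w, w : T3)).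
  by apply: measurable_fun_pair.
by have := md measurableT S mS; rewrite setTI.
Qed.

Let P_indicator (S : set T) : measurable S -> \int[P]_w (\1_S w)%:E = P S.
Proof. by move=> mS; rewrite integral_indic// setIT. Qed.

Let m_indic3 (S : set ((T1 * T2) * T3)) : measurable S ->
  measurable_fun setT (fun z => (\1_S z)%:E : \bar R).
Proof. by move=> mS; exact/measurable_EFinP. Qed.

Let indic3_ge0 (S : set ((T1 * T2) * T3)) z : 0 <= (\1_S z)%:E :> \bar R.
Proof. by rewrite lee_fin. Qed.

Let P_pullback (S : set ((T1 * T2) * T3)) : measurable S ->
  P (pullback S) = \int[P]_v \int[P]_w (\1_S (diag w, v : T3))%:E.
Proof.
move=> mS; rewrite -(integral_diag_positions (m_indic3 mS) (@indic3_ge0 S)).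
by rewrite -P_indicator//; exact: measurable_pullback.
Qed.

Let m_section3 (S : set ((T1 * T2) * T3)) v : measurable S ->
  measurable_fun setT (fun z : T1 * T2 => (\1_S (z, v : T3))%:E : \bar R).
Proof.
by move=> mS; exact: (measurableT_comp (m_indic3 mS) (pair2_measurable (v : T3))).
Qed.

Let tie_null : P (pullback tie3) = 0.
Proof.
rewrite P_pullback// integral0_eq// => v _.
(* With eavesdropper gains and positions frozen, a tie is the event that the minimal hop SNR hits a
   constant. *)
rewrite (integral_diagC (m_section3 v measurable_tie3))//.
rewrite integral0_eq// => u _.
have mt : measurable [set w | (m w)%:E = sup_snr u v].
  have mm : measurable_fun setT (EFin \o m).
    by apply/measurable_EFinP; exact: (measurableT_comp m_T1 mid1).
  by have := mm measurableT [set sup_snr u v] (emeasurable_set1 _); rewrite setTI.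
have tie0 : P [set w | (m w)%:E = sup_snr u v] = 0.
  exact: (min_hop_snr_no_atom alpha A_inj p_gt0 g_exp N_gt0).
by rewrite -tie0 -P_indicator.
Qed.

Let eve_indep : mutually_independent P (fun c : 'I_N * nat => (gE c.1 c.2 : T -> R)).
Proof.
have inj : injective (@inr 'I_N ('I_N * nat)) by move=> b c [].
have := mutually_independent_comp gains_indep inj.
by rewrite (_ : (fun c => G (inr c)) = (fun c => (gE c.1 c.2 : T -> R)))//;
  apply/funext => -[].
Qed.

Let eve_indep_at j : mutually_independent P (fun k => (gE k j : T -> R)).
Proof.
have inj : injective (fun k : 'I_N => (k, j)) by move=> k l [].
exact: (mutually_independent_comp eve_indep inj).
Qed.

Let phi t := escape_exponent A p alpha t.

Let phi_ge0 t x : (0 < t)%R -> (0 <= phi t x)%R.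
Proof.
exact: (escape_exponent_ge0 A p alpha N_gt0
  (fun k => mgE k 0) (eve_indep_at 0) (fun k => @gE_exp k 0%N)).
Qed.

Let m_phi t : measurable_fun setT (phi t).
Proof. exact: measurable_escape_exponent. Qed.

Let Phi (v w1 : T) := \int[P]_u (\1_safe3 ((w1, u), v))%:E.

Let PhiE v w1 : Phi v w1 = P [set u | forall j, (snr j u v <= m w1)%R].
Proof.
rewrite -P_indicator//.
rewrite (_ : [set u | _] = \bigcap_j [set u | (snr j u v <= m w1)%R]).
  apply: bigcap_measurable => // j _; apply: measurable_set_ler => //.
  by apply: measurable_received_snr => k; exact: mgE.
by apply/seteqP; split => u H j; [move=> _|]; exact: H.
Qed.

Let m_Phi : measurable_fun setT (fun z : T * T => Phi z.1 z.2).
Proof.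
have mf : measurable_fun setT (fun z : (T * T) * T =>
    (\1_safe3 ((z.1.2 : T1, z.2 : T2), z.1.1 : T3))%:E : \bar R).
  apply: (measurableT_comp (m_indic3 measurable_safe3)).
  apply: measurable_fun_pair; [apply: measurable_fun_pair|].
  - apply: (measurableT_comp mid1).
    exact: (measurableT_comp measurable_snd measurable_fst).
  - exact: (measurableT_comp mid2 measurable_snd).
  - apply: (measurableT_comp mid3).
    exact: (measurableT_comp measurable_fst measurable_fst).
exact: (measurable_fun_fubini_tonelli_F (m2 := P) _ mf (fun z => indic3_ge0 _ _)).
Qed.

Let Phi_ge0 v w1 : 0 <= Phi v w1.
Proof. exact: integral_ge0. Qed.

Let integral_Phi w1 : (0 < m w1)%R ->
  \int[P]_v Phi v w1 =
  (expR (- lambda * \int[area]_x scp_integrand A p alpha (m w1) x))%:E.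
Proof.
move=> m0; set t := m w1 in m0 *.
have q_fin := integral_interception_prob_fin A alpha_gt2 p_gt0 N_gt0
  (fun k => mgE k 0) (eve_indep_at 0) (fun k => @gE_exp k 0%N) m0.
have qE x : (1 - expR (- phi t x) = interception_prob A p alpha t x)%R.
  rewrite (expRN_escape_exponent A p alpha N_gt0 (fun k => mgE k 0) (eve_indep_at 0)
    (fun k => @gE_exp k 0%N))//.
  by rewrite opprB addrCA subrr addr0.
have phi_fin : \int[area]_x (1 - expR (- phi t x))%:E < +oo.
  by under eq_integral do rewrite qE.
have LF := poisson_laplace_functional (ltW lambda_gt0) E_poisson (m_phi t)
  (fun x => phi_ge0 x m0) phi_fin.
rewrite mulNr -(Rintegral_interception_prob alpha_gt2 A_inj p_gt0).
transitivity (\int[P]_v (expNe (\sum_(0 <= j <oo) (phi t (E j v))%:E))%:E); last first.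
  rewrite LF; congr (expR (- (_ * _)))%:E; congr fine.
  by apply: eq_integral => x _; rewrite qE.
apply: ae_eq_integral => //.
- exact: (measurableT_comp m_Phi (pair2_measurable w1)).
- apply/measurable_EFinP; apply: (measurableT_comp (@measurable_expNe R)).
  apply: ge0_emeasurable_sum => [j w _ _|j _]; first by rewrite lee_fin phi_ge0.
  by apply/measurable_EFinP; exact: (measurableT_comp (m_phi t) (mE j)).
- apply: (@negligibleS _ _ _ _ [set v | exists j, Z (E j v)]); last first.
    apply: (poisson_avoids_null E_poisson).
      exact: measurable_degenerate_points.
    exact: area_degenerate_points.
  move=> v /= Hv; apply: contrapT => nZ; apply: Hv => _.
  rewrite PhiE; apply: (all_safe_prob N_gt0 mgE eve_indep gE_exp m0) => j Zj.
  by apply: nZ; exists j.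
Qed.

Let P_safe : P (pullback safe3) =
  'E_P[fun w => expR (- lambda * \int[area]_x scp_integrand A p alpha (m w) x)].
Proof.
rewrite P_pullback// unlock.
transitivity (\int[P]_v \int[P]_w1 Phi v w1).
  by apply: eq_integral => v _; rewrite (integral_diag (m_section3 v measurable_safe3)).
(* The swap puts the positions inside, so that the Laplace functional is applied at a fixed
   threshold. *)
rewrite (fubini_tonelli (fun z : T * T => Phi z.1 z.2))//=.
apply: ae_eq_integral => //.
- exact: (measurable_fun_fubini_tonelli_G (m1 := P) (fun z : T * T => Phi z.1 z.2)).
- apply/measurable_EFinP; apply: measurableT_comp => //.
  apply: measurable_funM => //; apply: measurableT_comp; first exact: fine_measurable.
  apply: (measurable_integral_area (f := fun z : T * plane R =>
    (scp_integrand A p alpha (m z.1) z.2)%:E)).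
  apply/measurable_EFinP; apply: measurable_scp_integrand => //.
  apply: (measurableT_comp _ measurable_fst).
  exact: (measurableT_comp m_T1 mid1).
- apply: (@negligibleS _ _ _ _ [set w | (m w <= 0)%R]).
    move=> w /= Hw; rewrite leNgt; apply/negP => m0; apply: Hw => _.
    exact: integral_Phi.
  exact: (min_hop_snr_le0_negligible alpha A_inj p_gt0 g_exp N_gt0).
Qed.

(** One eavesdropper with a nonnegative SNR is enough for the supremum to be nonnegative, hence for
    the denominator in the logarithm to be at least 1. *)
Let first_snr_ge0 : P.-negligible [set w | (snr 0 w w < 0)%R].
Proof.
apply: (@negligibleS _ _ _ _ (\big[setU/set0]_(k < N) [set w | (gE k 0%N w < 0)%R])).
  move=> w /= Hw; apply: contrapT; rewrite -bigcup_seq => nk.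
  move: Hw; apply/negP; rewrite -leNgt; apply: sumr_ge0 => k _.
  rewrite mulr_ge0 ?invr_ge0 ?powR_ge0// mulr_ge0 ?(ltW (p_gt0 _))//.
  rewrite leNgt; apply/negP => gk; apply: nk; exists k => //.
  by rewrite /= mem_index_enum.
apply: (big_ind (fun S => P.-negligible S)).
- exact: negligible_set0.
- by move=> ? ?; exact: negligibleU.
- move=> k _; apply/negligibleP; first exact: measurable_set_ltr.
  exact: (exponential_lt0 (@gE_exp k 0%N)).
Qed.

Let log2e_gt0 (x : \bar R) : (0 < log2e x) = (1 < x).
Proof.
by rewrite /log2e pmule_lgt0 ?lne_gt0// lte_fin invr_gt0 ln_gt0// ltr1n.
Qed.

Let secure : set T := [set w | 0 < log2e ((1 + (m w)%:E) / (1 + sup_snr w w))].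

Let measurable_secure : measurable secure.
Proof.
have mm : measurable_fun setT (EFin \o m).
  by apply/measurable_EFinP; exact: (measurableT_comp m_T1 mid1).
have ms : measurable_fun setT (fun w => sup_snr w w).
  have md : measurable_fun setT (fun w : T => (diag w, w : T3)).
    exact: measurable_fun_pair.
  exact: (measurableT_comp m_sup3 md).
have mf : measurable_fun setT (fun w => (1 + (m w)%:E) / (1 + sup_snr w w)).
  apply: emeasurable_funM; first exact: emeasurable_funD.
  by apply: (measurableT_comp (@measurable_inve R)); exact: emeasurable_funD.
have := emeasurable_fun_o_infty measurableT mf 1; rewrite setTI.
by rewrite (_ : secure = [set w | 1 < (1 + (m w)%:E) / (1 + sup_snr w w)])//;
  apply/seteqP; split => w; rewrite /secure/= log2e_gt0.
Qed.

Let secureE w : (0 <= snr 0 w w)%R -> (m w)%:E <> sup_snr w w ->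
  secure w <-> forall j, (snr j w w <= m w)%R.
Proof.
move=> s0 ms; rewrite /secure/= log2e_gt0.
have M0 : 0 <= sup_snr w w.
  apply: (@le_trans _ _ (snr 0 w w)%:E); first by rewrite lee_fin.
  by apply: ereal_sup_ubound; exists 0%N.
have -> : (forall j, (snr j w w <= m w)%R) <-> sup_snr w w <= (m w)%:E.
  split => [H|H j].
    by apply: ge_ereal_sup => _ [j _ <-]; rewrite lee_fin.
  by rewrite -lee_fin (le_trans _ H)//; apply: ereal_sup_ubound; exists j.
have -> : (sup_snr w w <= (m w)%:E) = (sup_snr w w < (m w)%:E).
  by rewrite lt_neqAle andb_idl// => _; apply/eqP => /esym.
move: M0; case: (sup_snr w w) => [r| |]//= r0.
- have r1 : (0 < 1 + r)%R by apply: ltr_pwDl => //; rewrite -lee_fin.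
  rewrite -!EFinD /inve gt_eqF// -EFinM !lte_fin.
  by rewrite ltr_pdivlMr// mul1r ltrD2l.
(* An infinite supremum makes the quotient 0, so the path is not secure, and no finite SNR bounds
   that supremum. *)
- by rewrite addey// /inve mule0 lte_fin ltr10 ltNge leey.
Qed.

Let probability_ae_eq (S1 S2 Nl : set T) : measurable S1 -> measurable S2 ->
  P.-negligible Nl -> (forall w, ~ Nl w -> S1 w -> S2 w) -> P S1 <= P S2.
Proof.
move=> m1 m2 [M [mM M0 NM]] S12.
apply: (@le_trans _ _ (P (S2 `|` M))).
  rewrite le_measure ?inE//; first exact: measurableU.
  move=> w S1w; have [Mw|nM] := pselect (M w); [by right|left].
  by apply: S12 => // /NM.
by rewrite (le_trans (measureU2 _ m2 mM))// [X in _ + X]M0 adde0.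
Qed.

Lemma secure_connection_probabilityE :
  secure_connection_probability A p alpha g gE E N_gt0 =
  'E_P[fun w => expR (- lambda * \int[area]_x scp_integrand A p alpha (m w) x)].
Proof.
rewrite -P_safe; change (P secure = P (pullback safe3)).
have neg : P.-negligible ([set w | (snr 0 w w < 0)%R] `|` pullback tie3).
  apply: negligibleU => //; apply/negligibleP; last exact: tie_null.
  exact: measurable_pullback.
have eqE w : ~ ([set w | (snr 0 w w < 0)%R] `|` pullback tie3) w ->
    secure w <-> pullback safe3 w.
  move=> /not_orP[/negP s0 nt]; apply: secureE => //.
  by rewrite leNgt.
have msafe := measurable_pullback measurable_safe3.
apply/eqP; rewrite eq_le; apply/andP; split.
- by apply: (probability_ae_eq measurable_secure msafe neg) => w /eqE[].
- by apply: (probability_ae_eq msafe measurable_secure neg) => w /eqE[].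
Qed.

End secure_connection.

Theorem mainTheorem2 (R : realType) (d : measure_display)
    (T : measurableType d) (P : probability T R)
    (alpha lambda : R) (N : nat)
    (A : 'I_N.+1 -> R * R) (p : 'I_N -> R)
    (E : nat -> {RV P >-> plane R})
    (g : 'I_N -> {RV P >-> R}) (gE : 'I_N -> nat -> {RV P >-> R})
    (alpha_gt2 : 2 < alpha) (lambda_gt0 : 0 < lambda) (N_gt0 : (0 < N)%N)
    (A_inj : injective A) (p_gt0 : forall i, 0 < p i)
    (E_poisson : homogeneous_poisson_process lambda E)
    (g_exp : forall i (B : set R), measurable B ->
       distribution P (g i) B = exponential_prob 1 B)
    (gE_exp : forall k j (B : set R), measurable B ->
       distribution P (gE k j) B = exponential_prob 1 B)
    (gains_indep : mutually_independent P (all_gains g gE))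
    (gains_E_indep : independent_families P (all_gains g gE) E) :
  secure_connection_probability A p alpha g gE E N_gt0 =
  ('E_P[fun w => expR (- lambda *
     \int[area]_x scp_integrand A p alpha (min_hop_snr A p alpha g N_gt0 w) x)])%E.
Proof. exact: secure_connection_probabilityE. Qed.
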